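(* Let $\mathbf{K}\subset\mathbb{R}^m$ be a closed set with nonempty interior, let $\mu$ be a finite Borel measure supported on $\mathbf{K}$ whose moments $m_\alpha(\mathbf{K})=\int_{\mathbf{K}}z^\alpha\,d\mu(z)$, $\alpha\in\mathbb{N}_0^m$, are finite and available, and let $r>1$ and $d$ be fixed integers. Let $f(x,z)=\sum_{\beta\in N(m,d)}f_\beta(x)z^\beta$ with $f_\beta:\mathbb{R}^n\to\mathbb{R}$, and for $x\in\mathbb{R}^n$ define $$f_{\mathbf{K}}^{(r)}(x):=\sup_{h\in\Sigma[z]_r}\left\{\int_{\mathbf{K}}f(x,z)h(z)\,d\mu(z)\;:\;\int_{\mathbf{K}}h(z)\,d\mu(z)=1\right\}.$$ Assume that all $f_\beta$, $\beta\in N(m,d)$, are convex functions of $x$ whose subgradients are efficiently computable, and assume that $\mathbf{K}\subset\mathbb{R}^m_+$. Then the set $$\{x\in\mathbb{R}^n : f_{\mathbf{K}}^{(r)}(x)\le 0\}$$ is convex and admits a polynomial-time separating hyperplane oracle.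
   Context: For $z\in\mathbb{R}^m$ and $\alpha\in\mathbb{N}_0^m$, $z^\alpha=\prod_{i=1}^m z_i^{\alpha_i}$, and $N(m,d)=\{\alpha\in\mathbb{N}_0^m:\sum_{i=1}^m\alpha_i\le d\}$. $\Sigma[z]_r$ denotes the set of all sum-of-squares polynomials in $z=(z_1,\dots,z_m)$ of degree at most $2r$. $\mathbb{R}^m_+$ is the nonnegative orthant. A polynomial-time separating hyperplane oracle for a convex set $\mathcal{C}\subset\mathbb{R}^n$ is a polynomial-time procedure that, given $\bar x\in\mathbb{R}^n$, either reports that $\bar x\in\mathcal{C}$ or returns a linear inequality valid for all $x\in\mathcal{C}$ and violated by $\bar x$. For fixed $x$, $f_{\mathbf{K}}^{(r)}(x)$ is the optimal value of the semidefinite program in the coefficients $h_\alpha$ of $h(z)=\sum_{\alpha\in N(m,2r)}h_\alpha z^\alpha$: $$\sup\ \sum_{\beta\in N(m,d)}f_\beta(x)\sum_{\alpha\in N(m,2r)}h_\alpha m_{\alpha+\beta}(\mathbf{K})\quad\text{s.t.}\quad \sum_{\alpha\in N(m,2r)}h_\alpha m_\alpha(\mathbf{K})=1,\ \ \sum_{\alpha\in N(m,2r)}h_\alpha z^\alpha\in\Sigma[z]_r,$$ where the sum-of-squares condition is a linear matrix inequality. Semidefinite programs are regarded as solvable in polynomial time, and ''efficiently computable'' means computable in polynomial time. *)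

(* Defs.v *)
From HB Require Import structures.
From mathcomp Require Import all_boot all_order all_algebra.
From mathcomp Require mpoly.
From mathcomp Require Import all_classical all_reals all_analysis.
Import Order.TTheory GRing.Theory Num.Theory.
Import numFieldNormedType.Exports.
Import (coercions, canonicals) mpoly.

(* The notations of mpoly are not imported: they clash with those of
   MathComp-Analysis. *)

Set Implicit Arguments.
Unset Strict Implicit.
Unset Printing Implicit Defensive.

Local Open Scope classical_set_scope.
Local Open Scope ring_scope.

(* Exponents alpha in N_0^m, and the finite type N(m,d) of those with
   |alpha| <= d. *)
Notation exponent m := (mpoly.multinom m).
Notation exponent_le m d := (mpoly.bmultinom m d.+1).

(* R^m with its Borel sigma-algebra. *)
Notation borelRV R m := (g_sigma_algebraType (@open 'rV[R]_m)).

Section Problem.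
Context {R : realType}.

Definition monomial m (alpha : exponent m) (z : 'rV[R]_m) : R :=
  \prod_(i < m) z 0 i ^+ alpha i.

Definition peval m (h : mpoly.mpoly m R) (z : 'rV[R]_m) : R :=
  mpoly.meval (fun i => z 0 i) h.

(* Sigma[z]_r; [msize h] is 1 + deg h. *)
Definition sos_polynomials m (r : nat) : set (mpoly.mpoly m R) :=
  [set h | (exists s : seq (mpoly.mpoly m R), h = \sum_(p <- s) p ^+ 2) /\
           (mpoly.mmeasure (@mpoly.mdeg m) h <= (2 * r).+1)%N].

Definition nonneg_orthant m : set 'rV[R]_m := [set z | forall i, 0 <= z 0 i].

Definition moment m (mu : {finite_measure set (borelRV R m) -> \bar R})
    (K : set 'rV[R]_m) (alpha : exponent m) : R :=
  \int[mu]_(z in (K : set (borelRV R m))) monomial alpha z.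

Definition ffun_xz n m d (f : exponent_le m d -> 'rV[R]_n -> R)
    (x : 'rV[R]_n) (z : 'rV[R]_m) : R :=
  \sum_(beta : exponent_le m d) f beta x * monomial beta z.

(* The supremum is taken in the extended reals: it is -oo when mu = 0, where
   no h is normalized. *)
Definition fK n m d (mu : {finite_measure set (borelRV R m) -> \bar R})
    (K : set 'rV[R]_m) (f : exponent_le m d -> 'rV[R]_n -> R) (r : nat)
    (x : 'rV[R]_n) : \bar R :=
  ereal_sup [set (\int[mu]_(z in (K : set (borelRV R m)))
                    (ffun_xz f x z * peval h z))%:E |
             h in [set h | @sos_polynomials m r h /\
                     \int[mu]_(z in (K : set (borelRV R m))) peval h z = 1]].

Definition dotv n (u v : 'rV[R]_n) : R := \sum_(j < n) u 0 j * v 0 j.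

Definition is_subgradient n (f : 'rV[R]_n -> R) (x g : 'rV[R]_n) : Prop :=
  forall y, f x + dotv g (y - x) <= f y.

End Problem.

Section Semidefinite.
Context {R : realType}.

(* sup <C,X>  s.t.  <A_k,X> = b_k (k < p),  X positive semidefinite. *)
Record sdp (N p : nat) := Sdp {
  sdp_obj : 'M[R]_N;
  sdp_con : 'I_p -> 'M[R]_N;
  sdp_rhs : 'I_p -> R }.

Definition sdp_symmetric N p (D : sdp N p) : Prop :=
  (sdp_obj D)^T = sdp_obj D /\ forall k, (sdp_con D k)^T = sdp_con D k.

Definition mxdot N (A X : 'M[R]_N) : R := \sum_i \sum_j A i j * X i j.

Definition psd N (X : 'M[R]_N) : Prop :=
  X^T = X /\ forall v : 'rV[R]_N, 0 <= (v *m X *m v^T) 0 0.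

Definition sdp_feasible N p (D : sdp N p) : set 'M[R]_N :=
  [set X | psd X /\ forall k, mxdot (sdp_con D k) X = sdp_rhs D k].

(* To solve an SDP is to return an optimal solution, or to report that it is
   infeasible, that it is unbounded, or that its finite optimal value, which is
   then returned, is not attained.  Exactly one of the four cases occurs. *)
Inductive sdp_answer (N : nat) :=
| SdpInfeasible
| SdpUnbounded
| SdpOptimal of 'M[R]_N
| SdpUnattained of R.

Definition sdp_solved N p (D : sdp N p) (ans : sdp_answer N) : Prop :=
  match ans with
  | SdpInfeasible => forall X, ~ sdp_feasible D X
  | SdpUnbounded =>
      forall M : R, exists2 X, sdp_feasible D X & M < mxdot (sdp_obj D) X
  | SdpOptimal X => sdp_feasible D X /\
      forall Y, sdp_feasible D Y -> mxdot (sdp_obj D) Y <= mxdot (sdp_obj D) X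
  | SdpUnattained v =>
      (forall Y, sdp_feasible D Y -> mxdot (sdp_obj D) Y < v) /\
      (forall M : R, M < v ->
         exists2 X, sdp_feasible D X & M < mxdot (sdp_obj D) X)
  end.

Definition sdp_solver := forall N p : nat, sdp N p -> sdp_answer N.

Definition correct_sdp_solver (S : sdp_solver) : Prop :=
  forall N p (D : sdp N p), sdp_symmetric D -> sdp_solved D (S N p D).

End Semidefinite.
Arguments sdp : clear implicits.
Arguments sdp_answer : clear implicits.
Arguments sdp_solver : clear implicits.

(* Procedures are programs for a real-number random access machine (unit-cost
   exact arithmetic and comparisons on reals, and no conversion of reals to
   integers) with oracle instructions.  The memory consists of arrays of
   naturals and arrays of reals, named by constants of the program and indexed
   by finite sequences of naturals; a scalar variable is the cell of index
   [::].  Naturals serve for indexing and loop control only: they have no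
   multiplication, so that their unit-cost arithmetic stays within polynomial
   bit cost.  The only control structures are tests and bounded loops. *)

Inductive nexp :=
| NConst of nat
| NCell of nat & seq nexp
| NAdd of nexp & nexp
| NSub of nexp & nexp.

Inductive rexp :=
| RConst of int
| RCell of nat & seq nexp
| RAdd of rexp & rexp
| ROpp of rexp
| RMul of rexp & rexp
| RInv of rexp.

Inductive bexp :=
| NLe of nexp & nexp
| RLe of rexp & rexp.

Inductive cmd :=
| Skip
| NSet of nat & seq nexp & nexp
| RSet of nat & seq nexp & rexp
| Seq of cmd & cmd
| If of bexp & cmd & cmd
  (* [For v e c]: e is evaluated once, then c is run with v = 0, ..., e - 1 *)
| For of nat & nexp & cmd
  (* [GetMoment a ix s]: a[ix] := m_alpha, where alpha is read in the natural
     array s *)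
| GetMoment of nat & seq nexp & nat
  (* [GetValue a ix s y]: a[ix] := f_beta(x), where beta is read in the natural
     array s and x in the real array y *)
| GetValue of nat & seq nexp & nat & nat
  (* [GetSubgrad a s y]: a[0..n-1] := a subgradient of f_beta at x *)
| GetSubgrad of nat & nat & nat
  (* [SolveSdp st a N p c A b]: solves the SDP of order N with p constraints
     with objective c[i, j], constraints A[k, i, j] and right-hand sides b[k];
     a status is stored in the natural variable st, and the optimal solution in
     a[i, j], or else the unattained optimal value in the real variable a *)
| SolveSdp of nat & nat & nexp & nexp & nat & nat & nat.

Section Machine.
Context {R : realType}.

Record state := State {
  nmem : nat -> seq nat -> nat;
  rmem : nat -> seq nat -> R }.

Definition upd (T : Type) (M : nat -> seq nat -> T) a ix (v : T) :=
  fun b jx => if (b == a) && (jx == ix) then v else M b jx.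

Definition upd_vec n (M : nat -> seq nat -> R) a (v : 'rV[R]_n) :=
  fun b jx =>
    if b == a then
      if jx is [:: j] then if insub j is Some j' then v 0 j' else M b jx
      else M b jx
    else M b jx.

Definition upd_mx N (M : nat -> seq nat -> R) a (X : 'M[R]_N) :=
  fun b jx =>
    if b == a then
      if jx is [:: i; j] then
        if (insub i, insub j) is (Some i', Some j') then X i' j' else M b jx
      else M b jx
    else M b jx.

(* What the oracle instructions of an instance in dimensions n, m return, and
   the running times of the procedures that answer them. *)
Record oracles (n m d : nat) := Oracles {
  o_moment : exponent m -> R;
  o_value : exponent_le m d -> 'rV[R]_n -> R;
  o_subgrad : exponent_le m d -> 'rV[R]_n -> 'rV[R]_n;
  o_functime : nat;
  o_sdp : sdp_solver R;
  o_sdptime : nat -> nat -> nat }.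

Fixpoint neval (s : state) (e : nexp) : nat :=
  match e with
  | NConst k => k
  | NCell a ix => nmem s a (map (neval s) ix)
  | NAdd e1 e2 => (neval s e1 + neval s e2)%N
  | NSub e1 e2 => (neval s e1 - neval s e2)%N
  end.

Fixpoint reval (s : state) (e : rexp) : R :=
  match e with
  | RConst k => k%:~R
  | RCell a ix => rmem s a (map (neval s) ix)
  | RAdd e1 e2 => reval s e1 + reval s e2
  | ROpp e1 => - reval s e1
  | RMul e1 e2 => reval s e1 * reval s e2
  | RInv e1 => (reval s e1)^-1
  end.

Definition beval (s : state) (b : bexp) : bool :=
  match b with
  | NLe e1 e2 => (neval s e1 <= neval s e2)%N
  | RLe e1 e2 => reval s e1 <= reval s e2
  end.

Fixpoint ncost (e : nexp) : nat :=
  match e with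
  | NConst _ => 1
  | NCell _ ix => (sumn (map ncost ix)).+1
  | NAdd e1 e2 | NSub e1 e2 => (ncost e1 + ncost e2).+1
  end.

Definition icost (ix : seq nexp) : nat := sumn (map ncost ix).

Fixpoint rcost (e : rexp) : nat :=
  match e with
  | RConst _ => 1
  | RCell _ ix => (icost ix).+1
  | ROpp e1 | RInv e1 => (rcost e1).+1
  | RAdd e1 e2 | RMul e1 e2 => (rcost e1 + rcost e2).+1
  end.

Definition bcost (b : bexp) : nat :=
  match b with
  | NLe e1 e2 => (ncost e1 + ncost e2).+1
  | RLe e1 e2 => (rcost e1 + rcost e2).+1
  end.

Definition set_n (s : state) a ix k := State (upd (nmem s) a ix k) (rmem s).
Definition set_r (s : state) a ix x := State (nmem s) (upd (rmem s) a ix x).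

Definition read_exponent m (s : state) (a : nat) : exponent m :=
  mpoly.Multinom [tuple nmem s a [:: val i] | i < m].

Definition read_vec n (s : state) (a : nat) : 'rV[R]_n :=
  \row_(j < n) rmem s a [:: val j].

Definition read_sdp N p (s : state) (c A b : nat) : sdp R N p :=
  Sdp (\matrix_(i, j) rmem s c [:: val i; val j])
      (fun k => \matrix_(i, j) rmem s A [:: val k; val i; val j])
      (fun k => rmem s b [:: val k]).

Definition store_sdp_answer N (s : state) (st a : nat) (ans : sdp_answer R N) :=
  match ans with
  | SdpInfeasible => set_n s st [::] 0%N
  | SdpUnbounded => set_n s st [::] 1%N
  | SdpOptimal X =>
      set_n (State (nmem s) (upd_mx (rmem s) a X)) st [::] 2%N
  | SdpUnattained v => set_n (set_r s a [::] v) st [::] 3%N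
  end.

(* Running time and final state.  A request for f_beta with |beta| > d is
   answered by 0.  An oracle instruction is charged, besides the time of the
   procedure that answers it, for every cell that it reads or writes. *)
Fixpoint run n m d (O : oracles n m d) (c : cmd) (s : state) : nat * state :=
  match c with
  | Skip => (1%N, s)
  | NSet a ix e =>
      ((icost ix + ncost e).+1, set_n s a (map (neval s) ix) (neval s e))
  | RSet a ix e =>
      ((icost ix + rcost e).+1, set_r s a (map (neval s) ix) (reval s e))
  | Seq c1 c2 =>
      let: (t1, s1) := run O c1 s in
      let: (t2, s2) := run O c2 s1 in ((t1 + t2)%N, s2)
  | If b c1 c2 =>
      let: (t, s1) := run O (if beval s b then c1 else c2) s in
      ((bcost b + t)%N, s1)
  | For v e c1 =>
      iteri (neval s e)
        (fun k ts =>
           let: (t, s1) := run O c1 (set_n ts.2 v [::] k) in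
           ((ts.1 + t).+1, s1))
        ((ncost e).+1, s)
  | GetMoment a ix e =>
      ((icost ix + m).+1,
       set_r s a (map (neval s) ix) (o_moment O (read_exponent m s e)))
  | GetValue a ix e y =>
      ((icost ix + m + n + o_functime O).+1,
       set_r s a (map (neval s) ix)
         (if insub (read_exponent m s e) is Some beta
          then o_value O beta (read_vec n s y) else 0))
  | GetSubgrad a e y =>
      ((m + n + n + o_functime O).+1,
       State (nmem s) (upd_vec (rmem s) a
         (if insub (read_exponent m s e) is Some beta
          then o_subgrad O beta (read_vec n s y) else 0)))
  | SolveSdp st a eN ep cc cA cb =>
      let N := neval s eN in let p := neval s ep in
      ((ncost eN + ncost ep + N * N * p.+2 + p + o_sdptime O N p).+1,
       store_sdp_answer s st a (o_sdp O (read_sdp N p s cc cA cb)))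
  end.

(* Input: the natural variables 0 and 1 hold n and m, the real array 0 holds
   the query point; all other cells are 0. *)
Definition input n (m : nat) (x : 'rV[R]_n) : state :=
  State (upd (upd (fun _ _ => 0%N) 0%N [::] n) 1%N [::] m)
        (upd_vec (fun _ _ => 0) 0%N x).

(* Output: if the natural variable 2 is 0, the query point is reported to lie
   in C; otherwise the inequality <a,x> <= b is returned, with a in the real
   array 1 and b in the real variable 2. *)
Definition out_member (s : state) : bool := nmem s 2%N [::] == 0%N.
Definition out_normal n (s : state) : 'rV[R]_n := read_vec n s 1%N.
Definition out_bound (s : state) : R := rmem s 2%N [::].

Definition separates n m d (O : oracles n m d) (C : set 'rV[R]_n) (c : cmd) :=
  forall xbar : 'rV[R]_n,
    let s := (run O c (input m xbar)).2 in
    if out_member s then C xbar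
    else (forall x, C x -> dotv (out_normal n s) x <= out_bound s) /\
         out_bound s < dotv (out_normal n s) xbar.

End Machine.
Arguments state : clear implicits.
Arguments oracles : clear implicits.

Definition polynomially_bounded (I : Type) (size t : I -> nat) : Prop :=
  exists a k : nat, forall i, (t i <= a * (size i).+1 ^ k)%N.

(* One program for the whole family, with a running time bounded by a
   polynomial in n + m on all instances and query points. *)
Definition polytime_separation_oracle (R : realType) (I : Type) (n m : I -> nat)
    (d : nat) (O : forall i, oracles R (n i) (m i) d)
    (C : forall i, set 'rV[R]_(n i)) : Prop :=
  exists c : cmd,
    (forall i, separates (O i) (C i) c) /\
    polynomially_bounded
      (fun q : {i : I & 'rV[R]_(n i)} => n (tag q) + m (tag q))%N
      (fun q => (run (O (tag q)) c (input (m (tag q)) (tagged q))).1).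

(* Main.v *)
(* Write L(p) for the integral of a polynomial p over K and F_x for the
   polynomial f(x,.).  A sum of squares of degree at most 2r is a sum of squares
   of polynomials of degree at most r, and L(p^2) = 0 forces L(q p^2) = 0 by
   L((s + t p)^2) >= 0; hence x is in C iff L(F_x p^2) <= 0 for all p of degree
   at most r, that is, iff the matrix F(x) with entries L(F_x z^(a+b)) satisfies
   <F(x),X> <= 0 for all positive semidefinite X.  Since <F(x),X> is the sum of
   f_b(x) w_b(X), with w_b(X) = L(z^b h_X) >= 0 because K lies in the orthant, C
   is convex.

   The oracle does not solve the program defining f_K^(r), but the feasibility
   problem <F(x),X> = 1, X psd with objective 0: it is infeasible iff x is in C,
   and by homogeneity no attainment question arises.  A feasible X yields the
   cut <s,y> <= <s,x> - 1, where s is the sum of w_b(X) times a subgradient of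
   f_b at x. *)

Require Import Defs.
From mathcomp Require Import all_boot all_order all_algebra.
From mathcomp Require mpoly.
From mathcomp Require Import all_classical all_reals all_analysis.
From mathcomp Require Import ring lra zify.
Import Order.TTheory GRing.Theory Num.Theory.
Import numFieldNormedType.Exports.
Import (coercions, canonicals) mpoly.

Set Implicit Arguments.
Unset Strict Implicit.
Unset Printing Implicit Defensive.

Local Open Scope classical_set_scope.
Local Open Scope ring_scope.

(** The feasibility form spares the proof a compactness argument for the normalized [h] modulo
    squares of integral zero, and it needs no special case for a measure null on K, for which the
    defining program is infeasible and C is the whole space.

    The obstacle on the machine side is that one program serves all dimensions: the order of F(x)
    depends on m, so the exponents have to be listed at run time, with naturals that have no
    multiplication. Only [r] and [d] are constants of the program text. The lists grow by one letter
    at a time, and exponents are added entry by entry. The running time is then read off the text: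
    every loop makes at most [B] iterations, with [B] polynomial in n + m, and a single semidefinite
    program is solved. *)

(** * Enumeration of exponents by multisets *)

(* Nondecreasing sequences of k numbers <= m: each exponent of degree <= k in m
   variables occurs once, as the multiplicities of 0, ..., m - 1; the number m
   stands for the constant factor 1. *)
Fixpoint multisets (m k : nat) : seq (seq nat) :=
  if k is k'.+1 then
    [seq j :: t | t <- multisets m k', j <- iota 0 (head m t).+1]
  else [:: [::]].

(** Sequences grow from their largest entry: the default [m] of [head] bounds the first letter, and
    each further letter is bounded by the head before it. *)
Lemma mem_multisets m k t :
  (t \in multisets m k) =
  [&& size t == k, sorted leq t & all (fun j => j <= m)%N t].
Proof.
elim: k t => [|k IH] t; first by rewrite inE; case: t.
apply/flatten_mapP/idP => [[u + /mapP[j + ->]]|].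
  rewrite IH mem_iota add0n ltnS => /and3P[/eqP su sou au] ju.
  rewrite /= eqSS su eqxx au andbT /=.
  case: u su sou au ju => [|a u] //= _ -> /andP[am _] ja.
  by rewrite ja (leq_trans ja am).
case: t => // j u /and3P[su sou au].
exists u.
  by rewrite IH -eqSS su (path_sorted sou); case/andP: au.
apply/mapP; exists j => //; rewrite mem_iota add0n ltnS /=.
by case: u sou au {su} => [|a u] /= => [_ /andP[]|/andP[]].
Qed.

Lemma multisets_uniq m k : uniq (multisets m k).
Proof.
elim: k => // k IH; apply: (@allpairs_uniq_dep _ (fun=> nat)) => //.
  by move=> t _; exact: iota_uniq.
by move=> [t j] [u i] _ _ /= [-> ->].
Qed.

(** Every sequence has at most [m.+1] extensions. The bound is crude, but polynomial in [m] for
    fixed [k]. *)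
Lemma size_multisets m k : (size (multisets m k) <= m.+1 ^ k)%N.
Proof.
elim: k => // k IH; rewrite size_allpairs_dep expnSr.
apply: leq_trans (leq_mul IH (leqnn _)).
have -> : (size (multisets m k) * m.+1 = \sum_(t <- multisets m k) m.+1)%N.
  by rewrite big_const_seq count_predT iter_addn_0 mulnC.
rewrite sumnE big_map big_seq [leqRHS]big_seq.
apply: leq_sum => t; rewrite mem_multisets size_iota => /and3P[_ _].
by case: t => //= a t /andP[].
Qed.

Definition expo m (t : seq nat) : exponent m :=
  mpoly.Multinom [tuple count_mem (val i) t | i < m].

Lemma expoE m t (i : 'I_m) : expo m t i = count_mem (val i) t.
Proof. exact: mpoly.mnmE. Qed.

Lemma mdeg_expo m t : (mpoly.mdeg (expo m t) <= size t)%N.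
Proof.
rewrite mpoly.mdegE; under eq_bigr do rewrite expoE.
elim: t => [|a t IH] /=; first by rewrite big1.
rewrite big_split /= -add1n leq_add //.
have [am|am] := ltnP a m.
  rewrite (bigD1 (Ordinal am)) //= eqxx big1 // => i.
  by rewrite -val_eqE /= eq_sym => /negbTE ->.
by rewrite big1 // => i _; rewrite gtn_eqF // (leq_trans (ltn_ord i) am).
Qed.

(** The letter [m] makes up for the degree missing to [k], so the exponent determines its
    multiplicity as well; injectivity of [expo] rests on this. *)
Lemma count_mem_multiset m k t : t \in multisets m k ->
  k = (mpoly.mdeg (expo m t) + count_mem m t)%N.
Proof.
rewrite mem_multisets => /and3P[/eqP <- _ am].
rewrite mpoly.mdegE; under eq_bigr do rewrite expoE.
elim: t am => [|a t IH] /=; first by rewrite big1.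
move=> /andP[am at_]; rewrite big_split /= addnACA -(IH at_) -add1n; congr addn.
move: am; rewrite leq_eqVlt => /predU1P[->|am].
  by rewrite eqxx big1 // => i _; rewrite gtn_eqF.
rewrite (bigD1 (Ordinal am)) //= eqxx big1 => [|i].
  by rewrite ltn_eqF.
by rewrite -val_eqE /= eq_sym => /negbTE ->.
Qed.

Lemma expo_inj m k : {in multisets m k &, injective (expo m)}.
Proof.
move=> t u tm um e.
have ct := count_mem_multiset tm; have cu := count_mem_multiset um.
move: tm um; rewrite !mem_multisets.
move=> /and3P[_ st /allP amt] /and3P[_ su /allP amu].
(* A sorted sequence is determined by the multiplicities of its entries. *)
apply: (sorted_eq leq_trans anti_leq st su).
apply/allP => j; rewrite mem_cat => jtu /=.
have: (j <= m)%N by case/orP: jtu => [/amt|/amu].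
rewrite leq_eqVlt => /predU1P[->|jm].
  by apply/eqP/(@addnI (mpoly.mdeg (expo m t))); rewrite -ct e cu.
by have := congr1 (fun a : exponent m => a (Ordinal jm)) e; rewrite !expoE /= => ->.
Qed.

Lemma expo_surj m k (b : exponent m) : (mpoly.mdeg b <= k)%N ->
  exists2 t, t \in multisets m k & expo m t = b.
Proof.
move=> bk.
(* Each letter [i] taken [b i] times, then padded with [m] up to length [k]; sorting keeps the
   multiplicities. *)
pose s := flatten [seq nseq (b i) (val i) | i <- enum 'I_m] ++
  nseq (k - mpoly.mdeg b) m.
have cs (i : 'I_m) : count_mem (val i) s = b i.
  rewrite count_cat count_flatten -map_comp sumnE big_map big_enum /=.
  rewrite (bigD1 i) //= count_nseq /= eqxx mul1n big1 ?addn0.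
    by rewrite count_nseq /= gtn_eqF // mul0n addn0.
  move=> j; rewrite count_nseq /= -val_eqE /= eq_sym => /negbTE.
  by rewrite eq_sym => ->.
exists (sort leq s); last first.
  by apply/mpoly.mnmP => i; rewrite expoE (seq.permP (permEl (perm_sort leq s))).
rewrite mem_multisets size_sort sort_sorted ?all_sort; last exact: leq_total.
rewrite all_cat all_nseq leqnn orbT andbT size_cat size_flatten /shape -map_comp.
rewrite sumnE big_map big_enum /= size_nseq.
under eq_bigr do rewrite size_nseq.
rewrite -mpoly.mdegE subnKC // eqxx /=.
by apply/allP => j /flatten_mapP[i _ /nseqP[-> _]]; exact: ltnW.
Qed.

(** Passes from the positions over which the program loops to the finite type N(m,k) of the
    statement. *)
Lemma big_multisets (V : nmodType) m k (G : exponent m -> V) :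
  \sum_(i < size (multisets m k)) G (expo m (nth [::] (multisets m k) i)) =
  \sum_(b : exponent_le m k) G b.
Proof.
rewrite -(big_mkord xpredT (fun i => G (expo m (nth [::] (multisets m k) i)))).
rewrite -(big_nth [::] xpredT (fun t => G (expo m t))) /=.
rewrite -(big_map (expo m) xpredT G) -[RHS]big_enum -[RHS](big_map val xpredT G).
apply: perm_big; apply: uniq_perm.
- by rewrite map_inj_in_uniq ?multisets_uniq //; exact: expo_inj.
- by rewrite map_inj_uniq ?enum_uniq //; exact: val_inj.
move=> a; apply/mapP/mapP => [[t tm ->]|[b _ ->]]; last first.
  by have [|t tm e] := @expo_surj m k b; [rewrite -ltnS; exact: mpoly.bmdeg|exists t].
have et : (mpoly.mdeg (expo m t) < k.+1)%N.
  move: (tm); rewrite mem_multisets => /andP[/eqP sk _].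
  by rewrite ltnS -sk mdeg_expo.
by exists (mpoly.BMultinom et); rewrite ?mem_enum.
Qed.

(** * Positive semidefinite matrices and their trace pairing *)

(** If [b] were nonzero, [t = -(a + 1) / b] would give the value [-1]. This is the degenerate case
    of the Cauchy-Schwarz inequality, needed once for matrices and once for the integral. *)
Lemma linear_ge0_eq0 (R : realFieldType) (a b : R) :
  (forall t, 0 <= a + t * b) -> b = 0.
Proof.
move=> h; apply/eqP/negPn/negP => b0.
have := h (- (a + 1) / b); rewrite divfK //; lra.
Qed.

Section PositiveSemidefinite.
Context {R : realType}.

Lemma bilinear_sum N (A : 'M[R]_N) (v w : 'rV[R]_N) :
  (v *m A *m w^T) 0 0 = \sum_i \sum_j v 0 i * A i j * w 0 j.
Proof.
rewrite exchange_big mxE; apply: eq_bigr => j _.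
by rewrite !mxE mulr_suml.
Qed.

Lemma mxdotDr N (A X Y : 'M[R]_N) : mxdot A (X + Y) = mxdot A X + mxdot A Y.
Proof.
rewrite /mxdot -big_split; apply: eq_bigr => i _.
by rewrite -big_split; apply: eq_bigr => j _; rewrite mxE mulrDr.
Qed.

Lemma mxdotZr N (A X : 'M[R]_N) c : mxdot A (c *: X) = c * mxdot A X.
Proof.
rewrite /mxdot mulr_sumr; apply: eq_bigr => i _.
by rewrite mulr_sumr; apply: eq_bigr => j _; rewrite mxE mulrCA.
Qed.

Lemma mxdot_rank1 N (A : 'M[R]_N) (u : 'rV[R]_N) :
  mxdot A (u^T *m u) = (u *m A *m u^T) 0 0.
Proof.
rewrite bilinear_sum; apply: eq_bigr => i _; apply: eq_bigr => j _.
by rewrite mxE big_ord1 !mxE; ring.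
Qed.

Lemma psd_rank1 N (c : R) (u : 'rV[R]_N) : 0 <= c -> psd (c *: (u^T *m u)).
Proof.
move=> c0; split; first by rewrite linearZ /= trmx_mul trmxK.
move=> v; rewrite -scalemxAr -scalemxAl mxE mulr_ge0 //.
rewrite -!mulmxA mulmxA.
rewrite mxE big_ord1 (_ : u *m v^T = (v *m u^T)^T); last by rewrite trmx_mul trmxK.
by rewrite [_^T _ _]mxE -expr2 sqr_ge0.
Qed.

(** When [X i i = 0], the form at [t e_i + e_j] is [X j j + 2 t X i j], affine in [t]. *)
Lemma psd_diag_eq0 N (X : 'M[R]_N) i j : psd X -> X i i = 0 -> X i j = 0.
Proof.
move=> [Xs Xp] Xii; suff : 2 * X i j = 0 by lra.
apply: (@linear_ge0_eq0 _ (X j j)) => t.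
have := Xp (t *: delta_mx 0 i + delta_mx 0 j).
rewrite [(_ + _)^T]linearD /= [(_ *: _)^T]linearZ /= !mulmxDl !mulmxDr !trmx_delta.
rewrite -!scalemxAl -!scalemxAr -!rowE -!colE !mxE Xii.
have -> : X j i = X i j by rewrite -{1}Xs mxE.
by congr (0 <= _); ring.
Qed.

Lemma psd_sub_rank1 N (X : 'M[R]_N) i : psd X -> X i i != 0 ->
  psd (X - (X i i)^-1 *: ((row i X)^T *m row i X)).
Proof.
(* v X' v^T is the value of X at v - (s / X_ii) e_i, with s = (X v^T)_i *)
move=> [Xs Xp] Xii; split.
  by rewrite linearB /= linearZ /= trmx_mul trmxK Xs.
move=> v; set s := (row i X *m v^T) 0 0.
have := Xp (v - (s / X i i) *: delta_mx 0 i).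
rewrite [(_ - _)^T]linearB /= [(_ *: _)^T]linearZ /= !mulmxBl !mulmxBr !trmx_delta.
rewrite -!scalemxAl -!scalemxAr -!rowE -!colE.
have -> : col i (v *m X) = (row i X *m v^T)^T.
  by rewrite colE -mulmxA -colE trmx_mul trmxK tr_row Xs.
have e : v *m ((row i X)^T *m row i X) *m v^T =
    (row i X *m v^T)^T *m (row i X *m v^T).
  by rewrite trmx_mul trmxK !mulmxA.
move=> h; rewrite mulmxBl -scalemxAl e; move: h.
have E (a b c d : 'M[R]_1) : (a - b - (c - d)) 0 0 = a 0 0 - b 0 0 - (c 0 0 - d 0 0).
  by rewrite !mxE.
have E2 (a b : 'M[R]_1) : (a - b) 0 0 = a 0 0 - b 0 0 by rewrite !mxE.
have E3 c (a : 'M[R]_1) : (c *: a) 0 0 = c * a 0 0 by rewrite mxE.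
have E4 : ((row i X *m v^T)^T *m (row i X *m v^T)) 0 0 = s ^+ 2.
  by rewrite mxE big_ord1 [_^T _ _]mxE.
rewrite E E2 !E3 E4 -/s [_^T _ _]mxE -/s [col _ _ _ _]mxE [row _ _ _ _]mxE.
by congr (0 <= _); field.
Qed.

(** Cholesky elimination in place of the spectral theorem. Each step splits off a rank-one term,
    whose pairing with [A] is a value of the form of [A], clears the diagonal entry [i] and makes no
    zero diagonal entry nonzero. A semidefinite matrix with zero diagonal is zero. *)
Lemma mxdot_psd_ge0 N (A X : 'M[R]_N) :
  (forall v : 'rV[R]_N, 0 <= (v *m A *m v^T) 0 0) -> psd X -> 0 <= mxdot A X.
Proof.
move=> A0.
have [k] := ubnP #|[pred i | X i i != 0]|; elim: k X => // k IH X Xk Xp.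
have [i Xi|X0] := pickP [pred i | X i i != 0]; last first.
  rewrite /mxdot big1 // => i _; rewrite big1 // => j _.
  by rewrite (psd_diag_eq0 _ Xp) ?mulr0 //; apply/eqP; have /negbFE := X0 i.
rewrite -(subrK ((X i i)^-1 *: ((row i X)^T *m row i X)) X) mxdotDr.
have Xii : 0 <= X i i.
  have [_ /(_ (delta_mx 0 i))] := Xp.
  by rewrite trmx_delta -rowE -colE !mxE.
rewrite addr_ge0 ?mxdotZr ?mxdot_rank1 ?mulr_ge0 ?invr_ge0 //.
apply: IH; last exact: psd_sub_rank1.
rewrite -ltnS; apply: leq_trans Xk; apply: proper_card; apply/properP; split.
  apply/fintype.subsetP => j; rewrite !inE; apply: contra => /eqP Xj.
  rewrite !mxE big_ord1 !mxE Xj.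
  have -> : X i j = X j i by case: Xp => + _ => {1}<-; rewrite mxE.
  by rewrite (psd_diag_eq0 _ Xp Xj) mulr0 mulr0 subr0.
exists i; rewrite ?inE // !mxE big_ord1 !mxE negbK; apply/eqP.
rewrite mulrA mulVf // mul1r subrr //.
Qed.
End PositiveSemidefinite.

(** * Degrees of the summands of a sum of squares *)

Local Notation mon R a := (mpoly.mpolyX R a).

Section SumsOfSquares.
Context {R : realType} {m : nat}.
Implicit Types p q : mpoly.mpoly m R.

(* A sum of squares has positive coefficient at twice the largest leading
   exponent of the summands, so no cancellation of top degrees occurs. *)
Lemma sos_summand_size r (s : seq (mpoly.mpoly m R)) p : p \in s ->
  (mpoly.mmeasure (@mpoly.mdeg m) (\sum_(q <- s) q ^+ 2)%R <= (2 * r).+1)%N ->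
  (mpoly.mmeasure (@mpoly.mdeg m) p <= r.+1)%N.
Proof.
move=> ps hr; rewrite leqNgt; apply/negP => rp.
have [q qs qmax] : exists2 q, q \in s &
    forall q', q' \in s -> (mpoly.mlead q' <= mpoly.mlead q)%O.
  elim: s p ps {hr rp} => // a s IH _ _.
  have [->|[b s0]] : s = [::] \/ exists b, b \in s.
    by case: s {IH} => [|b s]; [left|right; exists b; rewrite mem_head].
    by exists a => [|q']; rewrite inE // => /eqP ->.
  have [q qs qmax] := IH _ s0.
  have [aq|qa] := leP (mpoly.mlead a) (mpoly.mlead q).
    exists q => [|q']; rewrite inE ?qs ?orbT // => /predU1P[->//|]; exact: qmax.
  exists a => [|q']; rewrite inE ?eqxx // => /predU1P[->//|/qmax /le_trans].
  by apply; exact: ltW.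
have p0 : p != 0 by rewrite -mpoly.msize_poly_eq0 -lt0n (leq_ltn_trans _ rp).
(* The monomial order refines the degree, so the largest leading exponent has at least the degree of
   [p]. *)
have rM : (r < mpoly.mdeg (mpoly.mlead q))%N.
  rewrite -ltnS in rp; move: rp; rewrite -mpoly.mlead_deg // !ltnS => /leq_trans.
  by apply; apply: mpoly.lemc_mdeg; exact: qmax.
have q0 : q != 0 by apply: contraTneq rM => ->; rewrite mpoly.mlead0 mpoly.mdeg0.
set M := mpoly.mlead q in rM qmax.
suff : mpoly.mcoeff (mpoly.mnm_add M M) (\sum_(q <- s) q ^+ 2) != 0.
  rewrite -mpoly.mcoeff_msupp => /mpoly.msize_mdeg_lt /leq_trans/(_ hr).
  by rewrite mpoly.mdegD; lia.
(* Since [M] dominates all leading exponents, [z^(2M)] occurs in [q ^+ 2] only through the square of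
   the term of [q] at [M]. *)
rewrite raddf_sum /= (eq_big_seq (fun q => mpoly.mcoeff M q ^+ 2)); last first.
  by move=> q' /qmax q'M; rewrite !expr2 mpoly.mleadcMW.
rewrite gt_eqF // (big_rem q) //= ltr_wpDr ?sumr_ge0 // => [? _|].
  exact: sqr_ge0.
by rewrite exprn_even_gt0 //= mpoly.mleadc_eq0.
Qed.
End SumsOfSquares.

(** * The integral as a functional on polynomials, and convexity *)

Section MomentFunctional.
Context {R : realType} {m : nat}.
Variables (mu : {finite_measure set (borelRV R m) -> \bar R}) (K : set 'rV[R]_m).
Hypothesis K_closed : closed K.
Hypothesis moments_finite : forall alpha : exponent m,
  mu.-integrable (K : set (borelRV R m)) (fun z => (monomial alpha z)%:E).
Implicit Types p q : mpoly.mpoly m R.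

Definition Lint p : R := \int[mu]_(z in (K : set (borelRV R m))) peval p z.

Lemma measurable_closed : measurable (K : set (borelRV R m)).
Proof.
rewrite -(setCK K); apply: measurableC.
by apply: sub_gen_smallest; rewrite openC.
Qed.

Lemma peval_mon (a : exponent m) z : peval (mon R a) z = monomial a z.
Proof. by rewrite /peval mpoly.mevalX. Qed.

Lemma pevalD p q z : peval (p + q) z = peval p z + peval q z.
Proof. exact: mpoly.mevalD. Qed.
Lemma pevalZ c p z : peval (c *: p) z = c * peval p z.
Proof. exact: mpoly.mevalZ. Qed.
Lemma pevalM p q z : peval (p * q) z = peval p z * peval q z.
Proof. exact: mpoly.mevalM. Qed.

Lemma integrable_peval p :
  mu.-integrable (K : set (borelRV R m)) (EFin \o peval p).
Proof.
rewrite [p]mpoly.mpolyE; elim/big_rec: _ => [|a q _ IH].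
  rewrite (_ : _ \o _ = cst 0%E); first exact: integrable0.
  by apply/funext => z /=; rewrite /peval mpoly.meval0.
rewrite (_ : _ \o _ = (fun z => (mpoly.mcoeff a p)%:E * (monomial a z)%:E) \+
   (EFin \o peval q))%E; last first.
  by apply/funext => z /=; rewrite pevalD pevalZ peval_mon.
apply: integrableD IH; first exact: measurable_closed.
by apply: integrableZl; first exact: measurable_closed.
Qed.

Lemma LintD p q : Lint (p + q) = Lint p + Lint q.
Proof.
rewrite /Lint -RintegralD; [|exact: measurable_closed|exact: integrable_peval..].
by apply: eq_Rintegral => z _; exact: pevalD.
Qed.

Lemma LintZ c p : Lint (c *: p) = c * Lint p.
Proof.
rewrite /Lint -RintegralZl; [|exact: measurable_closed|exact: integrable_peval].
by apply: eq_Rintegral => z _; exact: pevalZ.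
Qed.

Lemma Lint_sum I (s : seq I) (P : pred I) (F : I -> mpoly.mpoly m R) :
  Lint (\sum_(i <- s | P i) F i) = \sum_(i <- s | P i) Lint (F i).
Proof.
by apply: big_morph; [exact: LintD|rewrite -(scale0r 0) LintZ mul0r].
Qed.

Lemma Lint_mon a : Lint (mon R a) = moment mu K a.
Proof. by apply: eq_Rintegral => z _; exact: peval_mon. Qed.

Lemma Lint_ge0 p : (forall z, K z -> 0 <= peval p z) -> 0 <= Lint p.
Proof. by move=> h; apply: Rintegral_ge0. Qed.

Lemma peval_sqr_ge0 p z : 0 <= peval (p ^+ 2) z.
Proof. by rewrite expr2 pevalM -expr2 sqr_ge0. Qed.

Lemma Lint_sqr_null p q : Lint (p ^+ 2) = 0 -> Lint (p * q) = 0.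
Proof.
move=> p0; suff : 2 * Lint (p * q) = 0 by lra.
apply: (@linear_ge0_eq0 _ (Lint (q ^+ 2))) => t.
have -> : Lint (q ^+ 2) + t * (2 * Lint (p * q)) = Lint ((q + t *: p) ^+ 2).
  rewrite sqrrD !LintD exprZn LintZ p0 mulr0 addr0.
  by rewrite -(scalerAr t q p) LintZ [q * p]mulrC; ring.
by apply: Lint_ge0 => z _; exact: peval_sqr_ge0.
Qed.

Variables (n d : nat) (f : exponent_le m d -> 'rV[R]_n -> R).

Definition fpoly (x : 'rV[R]_n) : mpoly.mpoly m R :=
  \sum_(b : exponent_le m d) f b x *: mon R (b : exponent m).

Lemma peval_fpoly x z : peval (fpoly x) z = ffun_xz f x z.
Proof.
rewrite /peval raddf_sum; apply: eq_bigr => b _.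
by rewrite /= mpoly.mevalZ mpoly.mevalX.
Qed.

Lemma Lint_fpolyM x q :
  Lint (fpoly x * q) = \sum_(b : exponent_le m d) f b x * Lint (mon R (b : exponent m) * q).
Proof.
rewrite /fpoly mulr_suml Lint_sum; apply: eq_bigr => b _.
by rewrite -scalerAl LintZ.
Qed.

(** Gets rid of the normalization and of the extended supremum: what remains are inequalities linear
    in the values of the [f_b] at [x]. *)
Lemma fK_le0P r x : (fK mu K f r x <= 0)%E <->
  forall p, (mpoly.mmeasure (@mpoly.mdeg m) p <= r.+1)%N ->
    Lint (fpoly x * p ^+ 2) <= 0.
Proof.
have ffE h : \int[mu]_(z in (K : set (borelRV R m))) (ffun_xz f x z * peval h z) =
    Lint (fpoly x * h).
  by apply: eq_Rintegral => z _; rewrite pevalM peval_fpoly.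
split => [fx p pr|H].
  have := @Lint_ge0 (p ^+ 2) (fun z _ => peval_sqr_ge0 p z).
  rewrite le_eqVlt eq_sym => /predU1P[/Lint_sqr_null p0|p0].
    (* A square of integral zero cannot be normalized; [Lint_sqr_null] is used with
       [q = fpoly x * p]. *)
    by rewrite expr2 mulrCA p0.
  set c := Lint (p ^+ 2) in p0.
  pose h : mpoly.mpoly m R := c^-1 *: p ^+ 2.
  have : ((Lint (fpoly x * h))%:E <= 0)%E.
    apply: le_trans fx; apply: ereal_sup_ubound; exists h; last by rewrite ffE.
    split; last first.
      by rewrite -/(Lint h) LintZ mulVf // gt_eqF.
    split.
      exists [:: (Num.sqrt c^-1) *: p]; rewrite big_seq1 exprZn sqr_sqrtr //.
      by rewrite invr_ge0 ltW.
    apply: leq_trans (mpoly.mmeasureZ_le _ _ _) _.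
    have [->|pn0] := eqVneq p 0; first by rewrite expr0n /= mpoly.mmeasure0.
    rewrite expr2 mpoly.msizeM //; move: pr; set k := mpoly.mmeasure _ _ => pr; lia.
  rewrite lee_fin -scalerAr LintZ pmulr_rle0 // invr_gt0 //.
apply: ge_ereal_sup => _ [h [[[s ->] hr] h1] <-].
rewrite lee_fin ffE mulr_sumr Lint_sum big_seq sumr_le0 // => p ps.
by apply: H; exact: sos_summand_size hr.
Qed.

Lemma fK_le0_convex r
  (f_convex : forall b, convex_function [set: convex_lmodType 'rV[R]_n] (f b))
  (K_nonneg : K `<=` @nonneg_orthant R m) :
  convex_set ([set x : 'rV[R]_n | (fK mu K f r x <= 0)%E]
     : set (convex_lmodType 'rV[R]_n)).
Proof.
move=> x y t; rewrite !inE /= => /fK_le0P Hx /fK_le0P Hy.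
apply/fK_le0P => p pr; have {Hx Hy} := (Hx p pr, Hy p pr).
rewrite !Lint_fpolyM => -[Hx Hy].
have w0 (b : exponent_le m d) : 0 <= Lint (mon R (b : exponent m) * p ^+ 2).
  apply: Lint_ge0 => z /K_nonneg zK; rewrite pevalM peval_mon.
  by rewrite mulr_ge0 ?peval_sqr_ge0 // prodr_ge0 // => i _; rewrite exprn_ge0.
set X := \sum_b _ in Hx; set Y := \sum_b _ in Hy.
have : t%:num * X + (1 - t%:num) * Y <= 0.
  have t0 : 0 <= t%:num by [].
  have t1 : t%:num <= 1 by [].
  nra.
apply: le_trans; rewrite /X /Y !mulr_sumr -big_split; apply: ler_sum => b _.
rewrite /= (mulrA t%:num) (mulrA (1 - _)) -mulrDl ler_wpM2r ?w0 //.
by have := f_convex b t x y; rewrite !in_setT => /(_ isT isT).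
Qed.

End MomentFunctional.

(** * The matrix of the feasibility problem, its solutions and the cut *)

Definition exps m k (i : nat) : exponent m := expo m (nth [::] (multisets m k) i).

Section FeasibilityProblem.
Context {R : realType} {m : nat}.
Variables (mu : {finite_measure set (borelRV R m) -> \bar R}) (K : set 'rV[R]_m).
Hypothesis K_closed : closed K.
Hypothesis moments_finite : forall alpha : exponent m,
  mu.-integrable (K : set (borelRV R m)) (fun z => (monomial alpha z)%:E).
Variables (n d r : nat) (f : exponent_le m d -> 'rV[R]_n -> R).
Local Notation N := (size (multisets m r)).
Local Notation e := (exps m r).

(** The truncated localizing matrix of the polynomial f(x,.) in the monomial basis. *)
Definition gram_mx (x : 'rV[R]_n) : 'M[R]_N :=
  \matrix_(i, j) \sum_(b : exponent_le m d)
    f b x * moment mu K (mpoly.mnm_add (mpoly.mnm_add (e i) (e j)) b).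

(** The integral of [z^b h_X], where [h_X] is the polynomial with Gram matrix [X]. *)
Definition weight (X : 'M[R]_N) (b : exponent m) : R :=
  \sum_i \sum_j X i j * moment mu K (mpoly.mnm_add (mpoly.mnm_add (e i) (e j)) b).

Lemma mxdot_gram x X :
  mxdot (gram_mx x) X = \sum_(b : exponent_le m d) f b x * weight X b.
Proof.
rewrite /mxdot /weight.
under [RHS]eq_bigr do rewrite mulr_sumr.
rewrite [RHS]exchange_big; apply: eq_bigr => i _ /=.
under [RHS]eq_bigr do rewrite mulr_sumr.
rewrite [RHS]exchange_big; apply: eq_bigr => j _ /=.
by rewrite mxE mulr_suml; apply: eq_bigr => b _; rewrite -mulrA; congr (_ * _); rewrite mulrC.
Qed.

Definition row_poly (v : 'rV[R]_N) : mpoly.mpoly m R := \sum_i v 0 i *: mon R (e i).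

Lemma row_poly_onto p : (mpoly.mmeasure (@mpoly.mdeg m) p <= r.+1)%N ->
  exists v, row_poly v = p.
Proof.
move=> pr; exists (\row_i mpoly.mcoeff (e i) p).
rewrite [RHS](mpoly.mpolywE pr).
rewrite -(big_multisets _ (fun a => mpoly.mcoeff a p *: mon R a)).
by apply: eq_bigr => i _; rewrite mxE.
Qed.

Lemma weight_rank1 v b : weight (v^T *m v) b = Lint mu K (mon R b * row_poly v ^+ 2).
Proof.
rewrite /weight expr2 {1}/row_poly mulr_suml mulr_sumr Lint_sum //.
apply: eq_bigr => i _.
rewrite /row_poly !mulr_sumr Lint_sum //; apply: eq_bigr => j _.
rewrite mxE big_ord1 mxE -Lint_mon !mpoly.mpolyXD -LintZ //; congr Lint.
by rewrite -!scalerAl -!scalerAr scalerA [_ * mon R b]mulrC [v ord0 i * _]mulrC.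
Qed.

Lemma gram_quadratic x v :
  (v *m gram_mx x *m v^T) 0 0 = Lint mu K (fpoly f x * row_poly v ^+ 2).
Proof.
rewrite -mxdot_rank1 mxdot_gram Lint_fpolyM //.
by apply: eq_bigr => b _; rewrite weight_rank1.
Qed.

Lemma gram_sym x : (gram_mx x)^T = gram_mx x.
Proof.
apply/matrixP => i j; rewrite !mxE; apply: eq_bigr => b _.
by rewrite [mpoly.mnm_add (e j) _]mpoly.addmC.
Qed.

(** True pointwise under the integral: at [z] the integrand is [z^b] times the form of [X] at the
    vector of monomials of [z]. Thus [X] need not be split into squares. *)
Lemma weight_ge0 X b : K `<=` @nonneg_orthant R m -> psd X -> 0 <= weight X b.
Proof.
move=> K0 [_ X0].
have -> : weight X b =
    Lint mu K (\sum_i \sum_j X i j *: (mon R (e i) * mon R (e j) * mon R b)).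
  rewrite Lint_sum //; apply: eq_bigr => i _; rewrite Lint_sum //.
  by apply: eq_bigr => j _; rewrite LintZ // -!mpoly.mpolyXD Lint_mon.
apply: Lint_ge0 => z /K0 z0.
pose v : 'rV[R]_N := \row_i monomial (e i) z.
have -> : peval (\sum_i \sum_j X i j *: (mon R (e i) * mon R (e j) * mon R b)) z =
    (v *m X *m v^T) 0 0 * monomial b z.
  rewrite bilinear_sum mulr_suml /peval raddf_sum; apply: eq_bigr => i _.
  rewrite mulr_suml raddf_sum; apply: eq_bigr => j _.
  rewrite /= mpoly.mevalZ !mpoly.mevalM !mpoly.mevalX !mxE /monomial; ring.
by rewrite mulr_ge0 // prodr_ge0 // => i _; rewrite exprn_ge0.
Qed.

Lemma fK_le0_gram x : (fK mu K f r x <= 0)%E <->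
  forall X, psd X -> mxdot (gram_mx x) X <= 0.
Proof.
split=> [/(fK_le0P K_closed moments_finite) H X Xp|H].
  (* For [x] in C the form of [- gram_mx x] is nonnegative, and such a form pairs nonnegatively with
     [X]. *)
  have := @mxdot_psd_ge0 R N (- gram_mx x) X.
  rewrite /mxdot; under eq_bigr do under eq_bigr do rewrite mxE mulNr.
  under eq_bigr do rewrite sumrN; rewrite sumrN oppr_ge0; apply=> // v.
  rewrite mulmxN mulNmx mxE oppr_ge0 gram_quadratic; apply: H.
  apply: leq_trans (mpoly.mmeasure_sum _ _ _ _) _.
  apply/bigmax_leqP => i _; apply: leq_trans (mpoly.mmeasureZ_le _ _ _) _.
  rewrite mpoly.mmeasureX ltnS (leq_trans (mdeg_expo _ _)) //.
  by have := mem_nth [::] (ltn_ord i); rewrite mem_multisets => /andP[/eqP ->].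
(* Conversely, rank-one matrices suffice: they give all squares of polynomials of degree at most
   [r]. *)
apply/(fK_le0P K_closed moments_finite) => p /row_poly_onto[v <-].
rewrite -gram_quadratic -mxdot_rank1 -[v^T *m v]scale1r; apply: H.
exact: psd_rank1.
Qed.

(** With objective [0] every feasible point is optimal, which rules out two of the four answers. *)
Lemma feasibility_solved x ans :
  sdp_solved (Sdp 0 (fun=> gram_mx x) (fun=> 1) : sdp R N 1) ans ->
  match ans return Prop with
  | SdpInfeasible => (fK mu K f r x <= 0)%E
  | SdpOptimal X => psd X /\ mxdot (gram_mx x) X = 1
  | _ => False
  end.
Proof.
have dot0 Y : mxdot 0 Y = 0 :> R.
  by rewrite /mxdot big1 // => i _; rewrite big1 // => j _; rewrite mxE mul0r.
case: ans => [|/(_ 0)[X _]|X|v] /=.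
- move=> H; apply/fK_le0_gram => X Xp; rewrite leNgt; apply/negP => X0.
  (* A positive pairing can be scaled to [1] within the cone. *)
  apply: (H ((mxdot (gram_mx x) X)^-1 *: X)); split => [|_] /=.
    case: Xp => Xs Xp; split; first by rewrite linearZ /= Xs.
    by move=> v; rewrite -scalemxAr -scalemxAl mxE mulr_ge0 // invr_ge0 ltW.
  by rewrite mxdotZr mulVf // gt_eqF.
- by rewrite dot0 ltxx.
- by case=> -[Xp /(_ 0)].
(* A feasible point forces [0 < v]; approaching [v] then asks for a value above [0]. *)
- move=> [H1 H2]; have [|X /H1] := H2 (v - 1); first by rewrite ltrBlDr ltrDl.
  by rewrite dot0 => /H2[Y _]; rewrite dot0 ltxx.
Qed.

Variable g : exponent_le m d -> 'rV[R]_n -> 'rV[R]_n.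
Hypothesis g_subgradient : forall b x, is_subgradient (f b) x (g b x).

Lemma dotv_suml I (s : seq I) (w : I -> R) (u : I -> 'rV[R]_n) v :
  dotv (\sum_(i <- s) w i *: u i) v = \sum_(i <- s) w i * dotv (u i) v.
Proof.
rewrite /dotv; under [RHS]eq_bigr do rewrite mulr_sumr.
rewrite exchange_big; apply: eq_bigr => j _.
by rewrite summxE mulr_suml; apply: eq_bigr => i _; rewrite mxE mulrA.
Qed.

Lemma dotvBr (u v w : 'rV[R]_n) : dotv u (v - w) = dotv u v - dotv u w.
Proof.
by rewrite /dotv -sumrB; apply: eq_bigr => j _; rewrite !mxE mulrBr.
Qed.

(** For [y] in C, [0 >= <F(y),X> >= <F(x),X> + <a,y - x>], where nonnegative weights allow the
    subgradient inequalities to be added. The gap [1] is the normalization of [X]. *)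
Lemma subgradient_cut x y X : K `<=` @nonneg_orthant R m ->
  psd X -> mxdot (gram_mx x) X = 1 -> (fK mu K f r y <= 0)%E ->
  let a := \sum_(b : exponent_le m d) weight X b *: g b x in
  dotv a y <= dotv a x - 1.
Proof.
move=> K0 Xp x1 /fK_le0_gram /(_ X Xp) y0 /=.
suff : 1 + dotv (\sum_(b : exponent_le m d) weight X b *: g b x) (y - x) <= 0.
  by rewrite dotvBr; lra.
apply: le_trans y0; rewrite -x1 dotv_suml !mxdot_gram -big_split.
apply: ler_sum => b _; rewrite /= [f b y * _]mulrC [f b x * _]mulrC -mulrDr.
by rewrite ler_wpM2l ?weight_ge0 //; exact: g_subgradient.
Qed.

End FeasibilityProblem.

(** * Program logic: frames, running time and correctness *)

(** Whole arrays are recorded, since indices are known only at run time. *)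
Fixpoint nwrites (c : cmd) : seq nat :=
  match c with
  | Skip | RSet _ _ _ | GetMoment _ _ _ | GetValue _ _ _ _
  | GetSubgrad _ _ _ => [::]
  | NSet a _ _ => [:: a]
  | Seq c1 c2 | If _ c1 c2 => nwrites c1 ++ nwrites c2
  | For v _ c1 => v :: nwrites c1
  | SolveSdp st _ _ _ _ _ _ => [:: st]
  end.

Fixpoint rwrites (c : cmd) : seq nat :=
  match c with
  | Skip | NSet _ _ _ => [::]
  | RSet a _ _ | GetMoment a _ _ | GetValue a _ _ _ | GetSubgrad a _ _
  | SolveSdp _ a _ _ _ _ _ => [:: a]
  | Seq c1 c2 | If _ c1 c2 => rwrites c1 ++ rwrites c2
  | For _ _ c1 => rwrites c1
  end.

Section Programs.
Context {R : realType} {n m d : nat}.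
Variable O : oracles R n m d.
Implicit Types (c : cmd) (s : state R).

Definition same_except (V W : seq nat) s s' : Prop :=
  (forall a, a \notin V -> nmem s' a = nmem s a) /\
  (forall a, a \notin W -> rmem s' a = rmem s a).

Lemma same_except_trans V W s1 s2 s3 :
  same_except V W s1 s2 -> same_except V W s2 s3 -> same_except V W s1 s3.
Proof. by move=> [n1 r1] [n2 r2]; split=> a aV; rewrite ?n2 ?r2 ?n1 ?r1. Qed.

Lemma same_exceptW V W V' W' s s' : {subset V <= V'} -> {subset W <= W'} ->
  same_except V W s s' -> same_except V' W' s s'.
Proof.
move=> sV sW [hn hr]; split=> a aV; [apply: hn|apply: hr].
  by apply: contra aV; exact: sV.
by apply: contra aV; exact: sW.
Qed.

Lemma upd_other (T : Type) (M : nat -> seq nat -> T) a b ix v :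
  a != b -> upd M b ix v a = M a.
Proof. by move=> /negbTE ab; apply/funext => jx; rewrite /upd ab. Qed.

Lemma same_except_set_n s a ix k : same_except [:: a] [::] s (set_n s a ix k).
Proof. by split=> // b; rewrite inE => ba /=; exact: upd_other. Qed.

Lemma same_except_set_r s a ix x : same_except [::] [:: a] s (set_r s a ix x).
Proof. by split=> // b; rewrite inE => ba /=; exact: upd_other. Qed.

Lemma run_for v e c s :
  run O (For v e c) s =
  iteri (neval s e) (fun k ts =>
     let: (t, s1) := run O c (set_n ts.2 v [::] k) in ((ts.1 + t).+1, s1))
   ((ncost e).+1, s).
Proof. by []. Qed.

Lemma run_frame c s : same_except (nwrites c) (rwrites c) s (run O c s).2.
Proof.
elim: c s => //=.
- by move=> *; exact: same_except_set_n.
- by move=> *; exact: same_except_set_r.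
- move=> c1 IH1 c2 IH2 s.
  case E1: (run O c1 s) => [t1 s1]; case E2: (run O c2 s1) => [t2 s2] /=.
  have := IH1 s; have := IH2 s1; rewrite E1 E2 /= => h2 h1.
  apply: (same_except_trans (s2 := s1)).
    by apply: same_exceptW h1 => a; rewrite mem_cat => ->.
  by apply: same_exceptW h2 => a; rewrite mem_cat => ->; rewrite orbT.
- move=> b c1 IH1 c2 IH2 s.
  case: beval.
    have := IH1 s; case: run => t s1 /=.
    by apply: same_exceptW => a; rewrite mem_cat => ->.
  have := IH2 s; case: run => t s1 /=.
  by apply: same_exceptW => a; rewrite mem_cat => ->; rewrite orbT.
- move=> v e c IH s; elim: (neval s e) => //= k IHk.
  move: IHk; set s1 := iteri k _ _ => IHk.
  apply: (same_except_trans IHk); have := IH (set_n s1.2 v [::] k).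
  case: run => t s2 /= h.
  apply: (same_except_trans (s2 := set_n s1.2 v [::] k)).
    by apply: same_exceptW (same_except_set_n _ _ _ _) => a; rewrite ?inE // => ->.
  by apply: same_exceptW h => a; rewrite // inE => ->; rewrite orbT.
- by move=> *; exact: same_except_set_r.
- by move=> *; exact: same_except_set_r.
- move=> a e y s; split=> // b; rewrite inE => /negbTE ba /=.
  by apply/funext => jx; rewrite /upd_vec ba.
- move=> st a eN ep cc cA cb s; case: o_sdp => [||X|v] /=.
  + by apply: same_exceptW (same_except_set_n _ _ _ _).
  + by apply: same_exceptW (same_except_set_n _ _ _ _).
  + split=> b; rewrite inE => /negbTE ba /=; first by rewrite upd_other ?ba.
    by apply/funext => jx; rewrite /upd_mx ba.
  + by split=> b; rewrite inE => ba /=; rewrite upd_other.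
Qed.

(* An upper bound on the running time of runs in which every loop makes at most
   [B] iterations and every semidefinite program costs at most [S]. *)
Fixpoint time_bound (B S : nat) c : nat :=
  match c with
  | Skip => 1
  | NSet _ ix e => (icost ix + ncost e).+1
  | RSet _ ix e => (icost ix + rcost e).+1
  | Seq c1 c2 => time_bound B S c1 + time_bound B S c2
  | If b c1 c2 => bcost b + (time_bound B S c1 + time_bound B S c2)
  | For _ e c1 => (ncost e).+1 + B * (time_bound B S c1).+1
  | GetMoment _ ix _ => (icost ix + m).+1
  | GetValue _ ix _ _ => (icost ix + m + n + o_functime O).+1
  | GetSubgrad _ _ _ => (m + n + n + o_functime O).+1
  | SolveSdp _ _ eN ep _ _ _ => (ncost eN + ncost ep + S).+1
  end.

Variables B S : nat.

(** The time bound depends on the text of [c] and not on [s], so time and correctness compose by the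
    same rules; bounds on loops and on the semidefinite program remain as side conditions. *)
Definition ensures c s (Q : state R -> Prop) : Prop :=
  ((run O c s).1 <= time_bound B S c)%N /\ Q (run O c s).2.

(** The rule of consequence, with the frame property handed to the new postcondition. *)
Lemma ensures_weaken c s (Q Q' : state R -> Prop) : ensures c s Q ->
  (forall s', same_except (nwrites c) (rwrites c) s s' -> Q s' -> Q' s') ->
  ensures c s Q'.
Proof. by move=> [t q] h; split => //; apply: h q; exact: run_frame. Qed.

Lemma ensures_seq c1 c2 s (Q : state R -> Prop) :
  ensures c1 s (fun s1 => ensures c2 s1 Q) -> ensures (Seq c1 c2) s Q.
Proof.
rewrite /ensures /=; case: (run O c1 s) => t1 s1 /= [h1].
by case: (run O c2 s1) => t2 s2 /= [h2 q]; split=> //; exact: leq_add.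
Qed.

Lemma ensures_nset a ix e s (Q : state R -> Prop) :
  Q (set_n s a (map (neval s) ix) (neval s e)) -> ensures (NSet a ix e) s Q.
Proof. by split. Qed.

Lemma ensures_rset a ix e s (Q : state R -> Prop) :
  Q (set_r s a (map (neval s) ix) (reval s e)) -> ensures (RSet a ix e) s Q.
Proof. by split. Qed.

(** The invariant need only speak of written cells: everything else follows from the frame relative
    to the state before the loop. *)
Lemma ensures_for (P : nat -> state R -> Prop) v e c s (Q : state R -> Prop) :
  (neval s e <= B)%N -> P 0%N s ->
  (forall k s', (k < neval s e)%N ->
     same_except (v :: nwrites c) (rwrites c) s s' -> P k s' ->
     ensures c (set_n s' v [::] k) (P k.+1)) ->
  (forall s', same_except (v :: nwrites c) (rwrites c) s s' ->
     P (neval s e) s' -> Q s') ->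
  ensures (For v e c) s Q.
Proof.
move=> eB P0 PS PQ; rewrite /ensures run_for.
set F := fun k ts => _.
have H k : (k <= neval s e)%N ->
    let ts := iteri k F ((ncost e).+1, s) in
    [/\ (ts.1 <= (ncost e).+1 + k * (time_bound B S c).+1)%N,
      same_except (v :: nwrites c) (rwrites c) s ts.2 & P k ts.2].
  elim: k => [_|k IH ke] /=; first by split => //; rewrite mul0n addn0.
  have [] := IH (ltnW ke).
  set ts := iteri k _ _ => t1 f1 p1.
  have := PS k ts.2 ke f1 p1; have := run_frame c (set_n ts.2 v [::] k).
  rewrite /F /ensures.
  case: (run O c _) => t s2 /= f2 [t2 p2]; split => //.
    by rewrite mulSnr addnA addnS ltnS leq_add.
  apply: same_except_trans f1 _.
  apply: (same_except_trans (s2 := set_n ts.2 v [::] k)).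
    by apply: same_exceptW (same_except_set_n _ _ _ _) => a; rewrite ?inE // => ->.
  by apply: same_exceptW f2 => a; rewrite // inE => ->; rewrite orbT.
have [/= t f p] := H _ (leqnn _); split; last exact: PQ.
by apply: leq_trans t _; rewrite leq_add2l leq_mul2r eB orbT.
Qed.

Lemma ensures_get_moment a ix e s (Q : state R -> Prop) :
  Q (set_r s a (map (neval s) ix) (o_moment O (read_exponent m s e))) ->
  ensures (GetMoment a ix e) s Q.
Proof. by split. Qed.

Lemma ensures_get_value a ix e y s (Q : state R -> Prop) :
  Q (set_r s a (map (neval s) ix)
         (if insub (read_exponent m s e) is Some beta
          then o_value O beta (read_vec n s y) else 0)) ->
  ensures (GetValue a ix e y) s Q.
Proof. by split. Qed.

Lemma ensures_get_subgrad a e y s (Q : state R -> Prop) :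
  Q (State (nmem s) (upd_vec (rmem s) a
         (if insub (read_exponent m s e) is Some beta
          then o_subgrad O beta (read_vec n s y) else 0))) ->
  ensures (GetSubgrad a e y) s Q.
Proof. by split. Qed.

Lemma ensures_solve_sdp st a eN ep cc cA cb s (Q : state R -> Prop) N p :
  neval s eN = N -> neval s ep = p ->
  (N * N * p.+2 + p + o_sdptime O N p <= S)%N ->
  Q (store_sdp_answer s st a (o_sdp O (read_sdp N p s cc cA cb))) ->
  ensures (SolveSdp st a eN ep cc cA cb) s Q.
Proof.
move=> eN' ep' hS q; rewrite /ensures /= eN' ep'; split => //.
by rewrite ltnS -!addnA leq_add2l leq_add2l !addnA.
Qed.

(** Determines the whole array, including the cells that keep their contents; nested loops compose
    because of this. *)
Definition fills a (D : pred (seq nat)) (G : seq nat -> R) s s' : Prop :=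
  forall jx, rmem s' a jx = if D jx then G jx else rmem s a jx.

(** The values [G] do not depend on the iteration, so the domains are simply united, overlapping or
    not. *)
Lemma ensures_for_fills v e c s a (D : nat -> pred (seq nat)) G :
  (neval s e <= B)%N ->
  (forall k s', (k < neval s e)%N ->
     same_except (v :: nwrites c) (rwrites c) s s' ->
     ensures c (set_n s' v [::] k) (fills a (D k) G (set_n s' v [::] k))) ->
  ensures (For v e c) s
    (fills a (fun jx => has (fun k => D k jx) (iota 0 (neval s e))) G s).
Proof.
move=> eB h.
apply: (ensures_for
  (P := fun k => fills a (fun jx => has (fun k => D k jx) (iota 0 k)) G s)) => //.
move=> k s' ke f H; apply: ensures_weaken (h k s' ke f) _ => s2 _ F jx.
rewrite F -addn1 iotaD has_cat has_seq1 add0n [rmem _ _ _]H.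
by case: (D k jx); rewrite ?orbT ?orbF.
Qed.

Definition rsum v e a ix x :=
  Seq (RSet a ix (RConst 0)) (For v e (RSet a ix (RAdd (RCell a ix) x))).

(** The hypotheses range over all states that differ in the accumulator, and possibly the loop
    variable, because the expressions are evaluated while these change. *)
Lemma ensures_rsum v e a ix x s M ixv (X : nat -> R) :
  (M <= B)%N ->
  (forall s', same_except [:: v] [:: a] s s' -> map (neval s') ix = ixv) ->
  (forall s', same_except [::] [:: a] s s' -> neval s' e = M) ->
  (forall s' k, (k < M)%N -> same_except [:: v] [:: a] s s' ->
     nmem s' v [::] = k -> reval s' x = X k) ->
  ensures (rsum v e a ix x) s (fills a (pred1 ixv) (fun=> \sum_(k < M) X k) s).
Proof.
move=> MB hix he hx; apply/ensures_seq/ensures_rset.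
have f0 y : same_except [::] [:: a] s (set_r s a ixv y) by exact: same_except_set_r.
have f0' y : same_except [:: v] [:: a] s (set_r s a ixv y).
  exact: same_exceptW (f0 y).
rewrite hix; last by split.
apply: (ensures_for (P := fun k => fills a (pred1 ixv) (fun=> \sum_(i < k) X i) s)).
- by rewrite he.
- by move=> jx; rewrite /= /upd eqxx big_ord0.
- rewrite he // => k s' kM f H; apply: ensures_rset => jx.
  have f' : same_except [:: v] [:: a] s (set_n s' v [::] k).
    apply: same_except_trans (f0' 0) _; apply: same_except_trans f _.
    by apply: same_exceptW (same_except_set_n _ _ _ _).
  rewrite /= /upd eqxx hix // (hx _ k) //=; last by rewrite /upd !eqxx.
  by rewrite !H /= eqxx big_ord_recr; case: eqP.
- by rewrite /= he.
Qed.

(** The natural array 6 is the argument register from which oracle instructions read an exponent. *)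
Definition load l x := For l (NCell 1 [::]) (NSet 6 [:: NCell l [::]] x).

Lemma ensures_load l x s (al : exponent m) : l \notin [:: 1%N; 6%N] ->
  (m <= B)%N -> nmem s 1 [::] = m ->
  (forall s' (i : 'I_m), same_except [:: l; 6%N] [::] s s' -> nmem s' l [::] = i ->
     neval s' x = al i) ->
  ensures (load l x) s (fun s' => read_exponent m s' 6 = al).
Proof.
rewrite !inE negb_or => /andP[l1 l6] mB m1 hx.
apply: (ensures_for (P := fun k s' => forall i : 'I_m, (i < k)%N ->
   nmem s' 6 [:: val i] = al i)).
- by rewrite /= m1.
- by [].
- move=> k s' /=; rewrite m1 => km f H; apply: ensures_nset => i ik /=.
  rewrite /upd !eqxx /= eqseq_cons andbT.
  have f' : same_except [:: l; 6%N] [::] s (set_n s' l [::] k).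
    apply: same_except_trans f _.
    by apply: same_exceptW (same_except_set_n _ _ _ _) => a; rewrite ?inE // => ->.
  case: eqP => [ik'|/eqP ik'].
    by rewrite (hx _ i f') //= /upd !eqxx ik'.
  rewrite eq_sym (negbTE l6) /=; apply: H; move: ik; rewrite ltnS leq_eqVlt.
  by rewrite (negbTE ik').
- move=> s' _ /=; rewrite m1 => H; apply/mpoly.mnmP => i.
  by rewrite mpoly.mnmE H.
Qed.

End Programs.

(** * Building the lists of exponents in memory *)

(* For each k <= r + d the memory holds [multisets m k]: its size in the natural
   cell 3[k] and, for its i-th sequence, the head in 4[k, i] and the
   multiplicity of l in 5[k, i, l]. *)
Definition nvar a := NCell a [::].
Definition nsucc e := NAdd e (NConst 1).
Definition level_size k := NCell 3 [:: k].
Definition level_head k i := NCell 4 [:: k; i].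
Definition level_count k i l := NCell 5 [:: k; i; l].

(** The copying loop has [m + 1] rounds, as the padding letter is counted too. The size is
    incremented last, because until then it is the index of the new sequence. *)
Definition append_multiset :=
  let k' := nsucc (nvar 7) in
  Seq (NSet 4 [:: k'; level_size k'] (nvar 9))
  (Seq (For 10 (nsucc (nvar 1))
         (NSet 5 [:: k'; level_size k'; nvar 10]
            (level_count (nvar 7) (nvar 8) (nvar 10))))
  (Seq (NSet 5 [:: k'; level_size k'; nvar 9]
          (nsucc (level_count k' (level_size k') (nvar 9))))
       (NSet 3 [:: k'] (nsucc (level_size k'))))).

Definition build_level :=
  For 8 (level_size (nvar 7))
    (For 9 (nsucc (level_head (nvar 7) (nvar 8))) append_multiset).

Definition build_levels (h : nat) :=
  Seq (NSet 3 [:: NConst 0] (NConst 1))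
  (Seq (NSet 4 [:: NConst 0; NConst 0] (nvar 1))
       (For 7 (NConst h) build_level)).

Section Levels.
Context {R : realType} {n m d : nat}.
Variables (O : oracles R n m d) (B S : nat).
Implicit Types s : state R.

Definition stored s k (L : seq (seq nat)) : Prop :=
  nmem s 3 [:: k] = size L /\
  forall i, (i < size L)%N ->
    nmem s 4 [:: k; i] = head m (nth [::] L i) /\
    forall l, (l <= m)%N -> nmem s 5 [:: k; i; l] = count_mem l (nth [::] L i).

(** All levels share the arrays 3, 4 and 5, so frames of whole arrays are too coarse here. *)
Definition same_level k s s' : Prop :=
  forall a ix, a \in [:: 3; 4; 5]%N -> nmem s' a (k :: ix) = nmem s a (k :: ix).

Lemma same_level_trans k s1 s2 s3 :
  same_level k s1 s2 -> same_level k s2 s3 -> same_level k s1 s3.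
Proof. by move=> h1 h2 a ix aa; rewrite h2 ?h1. Qed.

Lemma same_level_set_n k s b ix x : b \notin [:: 3; 4; 5]%N ->
  same_level k s (set_n s b ix x).
Proof.
by move=> bb a jx aa; rewrite /= upd_other //; apply: contraNneq bb => <-.
Qed.

Lemma stored_same k s s' L : same_level k s s' -> stored s k L -> stored s' k L.
Proof.
move=> e [h3 h45]; split; first by rewrite e.
by move=> i /h45[h4 h5]; split => [|l lm]; rewrite e // h5.
Qed.

Lemma ensures_append_multiset s k i j t L : (m < B)%N -> (j <= m)%N ->
  nmem s 1%N [::] = m -> nmem s 7%N [::] = k -> nmem s 8%N [::] = i ->
  nmem s 9%N [::] = j ->
  (forall l, (l <= m)%N -> nmem s 5 [:: k; i; l] = count_mem l t) ->
  stored s k.+1 L ->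
  ensures O B S append_multiset s (fun s' => stored s' k.+1 (rcons L (j :: t)) /\
    forall k', k' != k.+1 -> same_level k' s s').
Proof.
move=> mB jm s1 s7 s8 s9 ht [h3 h45].
apply/ensures_seq/ensures_nset; rewrite /= s7 addn1 h3 s9.
set s2 := set_n _ _ _ _.
have e1 : neval s2 (nsucc (nvar 1)) = m.+1 by rewrite /= /upd /= s1 addn1.
apply/ensures_seq.
(* Cells outside the new row are unchanged, among them the row [[k; i]] being copied. *)
apply: (ensures_for (P := fun l s' =>
  (forall l', (l' < l)%N -> nmem s' 5 [:: k.+1; size L; l'] = count_mem l' t) /\
  (forall ix, (forall l', ix != [:: k.+1; size L; l']) -> nmem s' 5 ix = nmem s 5 ix))).
- by rewrite e1.
- by split.
- move=> l s'; rewrite e1 => lm [f _] [H1 H2].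
  have [f3 f7 f8] : [/\ nmem s' 3 = nmem s 3, nmem s' 7 = nmem s 7 &
    nmem s' 8 = nmem s 8] by rewrite !f.
  apply: ensures_nset; rewrite /= /upd /= f3 f7 f8 s7 s8 addn1 h3; split => [l'|ix hix].
    rewrite ltnS leq_eqVlt => /predU1P[->|l'l].
      rewrite eqxx H2 ?ht //= => l''; rewrite !eqseq_cons ltn_eqF //.
    by rewrite !eqseq_cons !eqxx andbT /= ltn_eqF // H1.
  by rewrite (negbTE (hix l)) H2.
rewrite e1 => s3 [f _] [H1 H2].
apply/ensures_seq/ensures_nset.
have [f3 f7 f9] : [/\ nmem s3 3 = nmem s 3, nmem s3 7 = nmem s 7 &
  nmem s3 9 = nmem s 9] by rewrite !f.
have f4 : nmem s3 4 = nmem s2 4 by rewrite f.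
rewrite /= f3 f7 f9 s7 s9 addn1 h3.
apply: ensures_nset; rewrite /= /upd /= f7 f3 s7 !addn1 h3 H1 //.
split; first split.
- by rewrite /= /upd !eqxx size_rcons.
- move=> i'; rewrite size_rcons ltnS leq_eqVlt /= /upd /= f4 /s2 /= /upd /= nth_rcons.
  case/predU1P => [->|i'L].
    rewrite !eqxx ltnn /=; split=> // l lm; rewrite !eqseq_cons !eqxx andbT /= eq_sym.
    by case: eqP => [->|_]; rewrite ?add1n // H1.
  have [h4 h5] := h45 _ i'L.
  rewrite i'L !eqseq_cons (ltn_eqF i'L) andbF /= h4; split => // l lm.
  rewrite !eqseq_cons (ltn_eqF i'L) andbF.
  by rewrite H2 ?h5 // => l'; rewrite !eqseq_cons (ltn_eqF i'L) andbF.
- move=> k' k'k a ix; rewrite !inE => /or3P[]/eqP ->; rewrite /= /upd /= ?f3 ?f4.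
  + by rewrite eqseq_cons (negbTE k'k).
  + by rewrite /s2 /= /upd eqseq_cons (negbTE k'k) andbF.
  + by rewrite eqseq_cons (negbTE k'k) H2 // => l'; rewrite eqseq_cons (negbTE k'k).
Qed.

Lemma ensures_build_level s k : (m.+1 ^ k <= B)%N -> (m < B)%N ->
  nmem s 1%N [::] = m -> nmem s 7%N [::] = k ->
  stored s k (multisets m k) -> stored s k.+1 [::] ->
  ensures O B S build_level s (fun s' => stored s' k.+1 (multisets m k.+1) /\
    forall k', k' != k.+1 -> same_level k' s s').
Proof.
move=> kB mB s1 s7 sk sk1.
have e3 : neval s (level_size (nvar 7)) = size (multisets m k).
  by rewrite /= s7 sk.1.
(* The block of extensions of [t]: [multisets m k.+1] is the concatenation of these blocks. The
   outer invariant is a prefix of whole blocks, the inner one adds part of a block. *)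
pose ch t := [seq j :: t | j <- iota 0 (head m t).+1].
apply: (ensures_for (P := fun i s' =>
  stored s' k.+1 (flatten (map ch (take i (multisets m k)))) /\
  forall k', k' != k.+1 -> same_level k' s s')).
- by rewrite e3 (leq_trans (size_multisets _ _)).
- by rewrite take0; split.
- rewrite e3 => i s' iL [f _] [H1 H2].
  set t := nth [::] (multisets m k) i.
  have tL : t \in multisets m k by exact: mem_nth.
  have [_] := stored_same (H2 k (negbT (ltn_eqF (ltnSn k)))) sk.
  move=> /(_ _ iL)[h4 h5].
  have [f1 f7] : nmem s' 1 = nmem s 1 /\ nmem s' 7 = nmem s 7 by rewrite !f.
  have e4 : neval (set_n s' 8 [::] i) (nsucc (level_head (nvar 7) (nvar 8))) =
      (head m t).+1.
    by rewrite /= /upd /= f7 s7 h4 addn1.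
  have htm : (head m t <= m)%N.
    move: tL; rewrite mem_multisets => /and3P[_ _].
    by case: (t) => //= a u /andP[].
  rewrite (take_nth [::]) // map_rcons flatten_rcons.
  apply: (ensures_for (P := fun j s'' =>
    stored s'' k.+1 (flatten (map ch (take i (multisets m k))) ++
       [seq j :: t | j <- iota 0 j]) /\
    forall k', k' != k.+1 -> same_level k' s s'')).
  + by rewrite e4; exact: leq_trans mB.
  + rewrite cats0; split; [exact: H1|move=> k' k'k].
    exact: same_level_trans (H2 k' k'k) (same_level_set_n _ _ _ _ _).
  + rewrite e4 => j s2 jh [g _] [H3 H4].
    have [g1 g7 g8] : [/\ nmem s2 1 = nmem s' 1, nmem s2 7 = nmem s' 7 &
        nmem s2 8 = nmem (set_n s' 8 [::] i) 8] by split; rewrite g.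
    apply: ensures_weaken (@ensures_append_multiset _ k i j t
      (flatten (map ch (take i (multisets m k))) ++ [seq j :: t | j <- iota 0 j])
      mB _ _ _ _ _ _ _) _.
    * by rewrite -ltnS (leq_trans jh).
    * by rewrite /= /upd /= g1 f1.
    * by rewrite /= /upd /= g7 f7.
    * by rewrite /= /upd /= g8.
    * by [].
    * move=> l lm; have [_] := stored_same (H4 k (negbT (ltn_eqF (ltnSn k)))) sk.
      by move=> /(_ _ iL)[_ /(_ _ lm)].
    * by [].
    move=> s3 _ [H5 H6]; split.
      by rewrite -[j.+1]addn1 iotaD map_cat /= add0n catA cats1.
    move=> k' k'k; apply: same_level_trans (H4 k' k'k) _.
    exact: same_level_trans (same_level_set_n _ _ _ _ _) (H6 k' k'k).
  + by rewrite e4.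
- move=> s' _; rewrite e3 take_size => -[H1 H2]; split => //.
Qed.

Lemma ensures_build_levels h s : (h <= B)%N -> (m < B)%N ->
  (forall k, (k < h)%N -> (m.+1 ^ k <= B)%N) ->
  nmem s 1%N [::] = m -> (forall ix, nmem s 3 ix = 0) ->
  (forall ix, nmem s 5 ix = 0) ->
  ensures O B S (build_levels h) s
    (fun s' => forall k, (k <= h)%N -> stored s' k (multisets m k)).
Proof.
move=> hB mB kB s1 s3 s5.
apply/ensures_seq/ensures_nset/ensures_seq/ensures_nset => /=.
set s2 := set_n _ _ _ _.
have s2_3 ix : nmem s2 3 ix = if ix == [:: 0%N] then 1%N else 0%N.
  by rewrite /s2 /= /upd /= s3.
have s2_1 : nmem s2 1 [::] = m by rewrite /s2 /= /upd /=.
(* Levels above [k] remain as they were initially, so that the next one starts with size 0. *)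
apply: (ensures_for (P := fun k s' =>
  (forall k', (k' <= k)%N -> stored s' k' (multisets m k')) /\
  (forall k', (k < k')%N -> same_level k' s2 s'))) => //.
(* Level 0 is the empty sequence alone, with the default head [m]; its multiplicities are the
   initial zeros of the memory. *)
- split=> // k'; rewrite leqn0 => /eqP ->; split; first by rewrite s2_3.
  case=> // _; by split=> [|l lm]; rewrite /s2 /= /upd /= ?s1 ?s5.
- move=> k s' /= kh [f _] [H1 H2].
  have f1 : nmem s' 1 = nmem s2 1 by rewrite f.
  have := @ensures_build_level (set_n s' 7 [::] k) k (kB k kh) mB.
  rewrite /= /upd /= f1 s2_1 => /(_ erefl erefl (H1 k (leqnn _)) _) H.
  apply: ensures_weaken (H _) _.
    split => //; by rewrite -[LHS]/(nmem s' 3 [:: k.+1]) (H2 k.+1) //.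
  move=> s4 _ [H3 H4]; split=> k'.
    rewrite leq_eqVlt => /predU1P[->//|k'k]; apply: stored_same (H1 k' k'k).
    apply: same_level_trans (same_level_set_n _ _ _ _ _) (H4 k' _) => //.
    by rewrite ltn_eqF.
  move=> kk'; apply: same_level_trans (H2 k' (ltnW kk')) _.
  apply: same_level_trans (same_level_set_n _ _ _ _ _) (H4 k' _) => //.
  by rewrite gtn_eqF.
- by move=> s' _ [].
Qed.
End Levels.

(** * The separation program and the correctness of its phases *)

Lemma has_iota (P : pred nat) k M : (k < M)%N -> P k -> has P (iota 0 M).
Proof. by move=> kM Pk; apply/hasP; exists k; rewrite // mem_iota. Qed.

Lemma neval_add (R : realType) (s : state R) e1 e2 :
  neval s (NAdd e1 e2) = (neval s e1 + neval s e2)%N.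
Proof. by []. Qed.

Definition rvar a ix := RCell a (map nvar ix).

(* Real arrays: 7 moments of z^(e_a + e_b + e_c), 8 values f_c(x), 9 subgradients,
   3 and 4 constraint and right-hand side of the semidefinite program (its
   objective, array 5, is never written, hence 0), 6 its solution X, 11 the
   weights w_c(X).  The status of the program in the natural variable 2 is 0 iff
   it is infeasible, so that it is also the output flag. *)
Section Oracle.
Variables r d : nat.

Definition level_var k i := level_count (NConst k) (nvar i) (nvar 10%N).
Definition gram_size := level_size (NConst r).
Definition value_size := level_size (NConst d).

Definition get_moments :=
  (For 11 gram_size (For 12 gram_size (For 13 value_size
    (Seq (load 10 (NAdd (NAdd (level_var r 11) (level_var r 12)) (level_var d 13)))
         (GetMoment 7 [:: nvar 11; nvar 12; nvar 13] 6)))))%N.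

Definition get_values :=
  (For 13 value_size
    (Seq (load 10 (level_var d 13)) (GetValue 8 [:: nvar 13] 6 0)))%N.

(** [GetSubgrad] fills an array with one index, hence the copy from array 10 into a row of array
    9. *)
Definition get_subgrads :=
  (For 13 value_size
    (Seq (load 10 (level_var d 13)) (Seq (GetSubgrad 10 6 0)
       (For 14 (nvar 0) (RSet 9 [:: nvar 13; nvar 14] (rvar 10 [:: 14]))))))%N.

Definition build_sdp :=
  (Seq (For 11 gram_size (For 12 gram_size
         (rsum 13 value_size 3 [:: NConst 0; nvar 11; nvar 12]
            (RMul (rvar 8 [:: 13]) (rvar 7 [:: 11; 12; 13])))))
      (RSet 4 [:: NConst 0] (RConst 1%R)))%N.

(** The double sum goes through the array 12 of inner sums, as [rsum] has a single summation
    index. *)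
Definition get_weights :=
  (Seq (For 13 value_size (For 11 gram_size
         (rsum 12 gram_size 12 [:: nvar 13; nvar 11]
            (RMul (rvar 6 [:: 11; 12]) (rvar 7 [:: 11; 12; 13])))))
      (For 13 value_size (rsum 11 gram_size 11 [:: nvar 13] (rvar 12 [:: 13; 11]))))%N.

Definition build_cut :=
  (Seq (For 14 (nvar 0) (rsum 13 value_size 1 [:: nvar 14]
         (RMul (rvar 11 [:: 13]) (rvar 9 [:: 13; 14]))))
  (Seq (rsum 14 (nvar 0) 13 [::] (RMul (rvar 1 [:: 14]) (rvar 0 [:: 14])))
       (RSet 2 [::] (RAdd (RCell 13 [::]) (RConst (- 1)%R)))))%N.

Definition solve_sdp := SolveSdp 2 6 gram_size (NConst 1) 5 3 4.

(** There is no test on the answer of the solver: the last two phases always run, and the cut they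
    leave is ignored when the flag is 0. *)
Definition separation_program :=
  Seq (build_levels (r + d)) (Seq get_moments (Seq get_values (Seq get_subgrads
    (Seq build_sdp (Seq solve_sdp (Seq get_weights build_cut)))))).

Section Phases.
Context {R : realType} {n m : nat}.
Variables (O : oracles R n m d) (B S : nat) (x : 'rV[R]_n).
Implicit Types s : state R.

Local Notation N := (size (multisets m r)).
Local Notation D := (size (multisets m d)).

(** The common precondition of the phases after the enumeration. None of them writes to an array
    mentioned here. *)
Definition ready s : Prop :=
  [/\ nmem s 0%N [::] = n, nmem s 1%N [::] = m, stored (m := m) s r (multisets m r),
      stored (m := m) s d (multisets m d) & read_vec n s 0 = x].

Lemma ready_same V W s s' : all (fun a => a \notin V) [:: 0; 1; 3; 4; 5]%N ->
  0%N \notin W -> same_except V W s s' -> ready s -> ready s'.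
Proof.
move=> /and5P[V0 V1 V3 V4 /andP[V5 _]] W0 [fn fr] [s0 s1 sr sd sx].
have same k : same_level k s s'.
  by move=> a ix; rewrite !inE => /or3P[]/eqP ->; rewrite fn.
split; rewrite ?fn //; [exact: stored_same sr|exact: stored_same sd|].
by rewrite -sx; apply/rowP => j; rewrite !mxE fr.
Qed.

Lemma ready_set_n s v ix k : v \notin [:: 0; 1; 3; 4; 5]%N ->
  ready s -> ready (set_n s v ix k).
Proof.
move=> vV; apply: ready_same (same_except_set_n _ _ _ _) => //.
by apply/allP => a aV; rewrite inE; apply: contraNneq vV => <-.
Qed.

Hypotheses (NB : (N <= B)%N) (DB : (D <= B)%N) (mB : (m <= B)%N) (nB : (n <= B)%N).

Lemma ready_gram s : ready s -> neval s gram_size = N.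
Proof. by case=> _ _ []. Qed.

Lemma ready_value s : ready s -> neval s value_size = D.
Proof. by case=> _ _ _ []. Qed.

Lemma ready_level_r s v i (l : 'I_m) : ready s -> nmem s v [::] = i -> (i < N)%N ->
  nmem s 10%N [::] = l -> neval s (level_var r v) = exps m r i l.
Proof.
move=> [_ _ [_ h] _ _] vi iN sl; rewrite /= vi sl expoE.
by have [_ ->] := h i iN; last exact: ltnW.
Qed.

Lemma ready_level_d s v i (l : 'I_m) : ready s -> nmem s v [::] = i -> (i < D)%N ->
  nmem s 10%N [::] = l -> neval s (level_var d v) = exps m d i l.
Proof.
move=> [_ _ _ [_ h] _] vi iN sl; rewrite /= vi sl expoE.
by have [_ ->] := h i iN; last exact: ltnW.
Qed.

Definition mom a b c : R :=
  o_moment O (mpoly.mnm_add (mpoly.mnm_add (exps m r a) (exps m r b)) (exps m d c)).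

(** The default is that of the machine; it never occurs, as [exps m d c] has degree at most [d]. *)
Definition fval c : R :=
  if insub (exps m d c) is Some beta then o_value O beta x else 0.

Definition fgrad c : 'rV[R]_n :=
  if insub (exps m d c) is Some beta then o_subgrad O beta x else 0.

Definition holds_moments s : Prop := forall a b c, (a < N)%N -> (b < N)%N ->
  (c < D)%N -> rmem s 7 [:: a; b; c] = mom a b c.

Lemma fills_pred1 a ix (G : seq nat -> R) y s1 s s' : G ix = y ->
  rmem s1 a = rmem s a -> fills a (pred1 ix) (fun=> y) s1 s' ->
  fills a (pred1 ix) G s s'.
Proof.
by move=> Gy e F jx; rewrite F e /=; case: eqP => // ->.
Qed.

Lemma ensures_get_moments s : ready s -> ensures O B S get_moments s holds_moments.
Proof.
move=> s0.
pose G jx := if jx is [:: a; b; c] then mom a b c else 0.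
suff : ensures O B S get_moments s (fills 7
    (fun jx => has (fun a => has (fun b => has (fun c => jx == [:: a; b; c])
       (iota 0 D)) (iota 0 N)) (iota 0 N)) G s).
  move/ensures_weaken; apply => s' _ F a b c aN bN cD; rewrite F.
  by rewrite (has_iota aN) // (has_iota bN) // (has_iota cD).
rewrite -{2}(ready_gram s0).
apply: ensures_for_fills; rewrite (ready_gram s0) // => a s1 aN f1.
have r1 : ready (set_n s1 11 [::] a).
  by apply: ready_set_n => //; apply: ready_same s0; last exact: f1.
rewrite -(ready_gram r1).
apply: ensures_for_fills; rewrite (ready_gram r1) // => b s2 bN f2.
have r2 : ready (set_n s2 12 [::] b).
  by apply: ready_set_n => //; apply: ready_same r1; last exact: f2.
rewrite -(ready_value r2).
apply: ensures_for_fills; rewrite (ready_value r2) // => c s3 cD f3.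
have r3 : ready (set_n s3 13 [::] c).
  by apply: ready_set_n => //; apply: ready_same r2; last exact: f3.
set s4 := set_n s3 13 [::] c in r3 *.
have v13 : nmem s4 13 [::] = c by [].
have v12 : nmem s4 12 [::] = b by rewrite /s4 /= /upd /= f3.1.
have v11 : nmem s4 11 [::] = a by rewrite /s4 /= /upd /= f3.1 //= /upd /= f2.1.
apply/ensures_seq.
apply: ensures_weaken (@ensures_load _ _ _ _ O B S 10%N _ s4
  (mpoly.mnm_add (mpoly.mnm_add (exps m r a) (exps m r b)) (exps m d c)) _ _ _ _) _ => //.
- by case: r3.
- move=> s' i f s'i; have r' : ready s' by apply: ready_same r3; last exact: f.
  rewrite !mpoly.mnmDE !neval_add.
  have w v : v != 10%N -> v != 6%N -> nmem s' v [::] = nmem s4 v [::].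
    by move=> v1 v2; rewrite f.1 // !inE negb_or v1.
  rewrite (ready_level_r r' (etrans (w 11%N _ _) v11) aN s'i) //.
  rewrite (ready_level_r r' (etrans (w 12%N _ _) v12) bN s'i) //.
  by rewrite (ready_level_d r' (etrans (w 13%N _ _) v13) cD s'i).
move=> s5 f5 al; apply: ensures_get_moment; rewrite al /=.
rewrite !f5.1 // v11 v12 v13.
apply: (@fills_pred1 _ _ _ (mom a b c) s5) => //; first by rewrite f5.2.
Qed.

Lemma ready_for_step v c s s' k : ready s ->
  all (fun a => a \notin v :: nwrites c) [:: 0; 1; 3; 4; 5]%N ->
  0%N \notin rwrites c ->
  same_except (v :: nwrites c) (rwrites c) s s' -> ready (set_n s' v [::] k).
Proof.
move=> sr vc rc f; apply: ready_set_n; last exact: ready_same vc rc f sr.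
by apply/negP => /(allP vc); rewrite mem_head.
Qed.

Lemma ensures_load_value s c : ready s -> (c < D)%N -> nmem s 13%N [::] = c ->
  ensures O B S (load 10%N (level_var d 13%N)) s
    (fun s' => read_exponent m s' 6%N = exps m d c).
Proof.
move=> sr cD s13; apply: ensures_load => //; first by case: sr.
move=> s' i f s'i; have r' : ready s' by apply: ready_same sr; last exact: f.
by rewrite (ready_level_d r' _ cD s'i) // f.1.
Qed.

Definition holds_values s : Prop :=
  forall c, (c < D)%N -> rmem s 8 [:: c] = fval c.

Lemma ensures_get_values s : ready s -> ensures O B S get_values s holds_values.
Proof.
move=> s0; pose G jx := if jx is [:: c] then fval c else 0.
suff : ensures O B S get_values s (fills 8
    (fun jx => has (fun c => jx == [:: c]) (iota 0 D)) G s).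
  by move/ensures_weaken; apply => s' _ F c cD; rewrite F (has_iota cD).
rewrite -(ready_value s0).
apply: ensures_for_fills; rewrite (ready_value s0) // => c s1 cD f1.
have r1 : ready (set_n s1 13 [::] c) by exact: ready_for_step f1.
apply/ensures_seq; apply: ensures_weaken (ensures_load_value r1 cD _) _ => //.
move=> s2 f2 al; apply: ensures_get_value; rewrite al /= f2.1 //.
apply: (@fills_pred1 _ _ _ (fval c) s2) => //; first by rewrite f2.2.
have [_ _ _ _ sx] : ready s2 by apply: ready_same r1; last exact: f2.
by move=> jx; rewrite /= /upd eqxx sx.
Qed.

Definition holds_subgrads s : Prop :=
  forall c (j : 'I_n), (c < D)%N -> rmem s 9 [:: c; val j] = fgrad c 0 j.

Lemma ensures_get_subgrads s : ready s ->
  ensures O B S get_subgrads s holds_subgrads.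
Proof.
move=> s0.
pose G jx := if jx is [:: c; j] then
  if insub j is Some j' then fgrad c 0 (j' : 'I_n) else 0 else 0.
suff : ensures O B S get_subgrads s (fills 9
    (fun jx => has (fun c => has (fun j => jx == [:: c; j]) (iota 0 n))
      (iota 0 D)) G s).
  move/ensures_weaken; apply => s' _ F c j cD.
  by rewrite F (has_iota cD) ?(has_iota (ltn_ord j)) // /G valK.
rewrite -(ready_value s0).
apply: ensures_for_fills; rewrite (ready_value s0) // => c s1 cD f1.
have r1 : ready (set_n s1 13 [::] c) by exact: ready_for_step f1.
apply/ensures_seq; apply: ensures_weaken (ensures_load_value r1 cD _) _ => //.
move=> s2 f2 al; apply/ensures_seq/ensures_get_subgrad; rewrite al.
have r2 : ready s2 by apply: ready_same r1; last exact: f2.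
have [_ _ _ _ sx] := r2.
rewrite sx -/(fgrad c); set s3 := State _ _.
have f3 : same_except [::] [:: 10%N] s2 s3.
  split=> // a; rewrite inE => /negbTE a10; apply/funext => jx.
  by rewrite /s3 /= /upd_vec a10.
have r3 : ready s3 by apply: ready_same r2; last exact: f3.
have s3n : neval s3 (nvar 0) = n by case: r3.
have : ensures O B S (For 14 (nvar 0) (RSet 9 [:: nvar 13; nvar 14] (rvar 10 [:: 14])))%N s3
    (fills 9 (fun jx => has (fun j => jx == [:: c; j])
      (iota 0 (neval s3 (nvar 0%N)))) G s3).
  apply: ensures_for_fills; rewrite s3n // => j s4 jn f4.
  apply: ensures_rset.
  have e13 : nmem s4 13 [::] = c by rewrite f4.1 //= f2.1.
  have e10 : rmem s4 10 [:: j] = fgrad c 0 (Ordinal jn).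
    by rewrite f4.2 //= /upd_vec eqxx insubT.
  move=> jx; rewrite /= /upd /= e13 e10.
  by case: eqP => // ->; rewrite /G insubT.
move/ensures_weaken; apply => s' _ F jx; by rewrite F s3n f3.2 // f2.2.
Qed.

Definition holds_sdp s : Prop :=
  (forall a b, (a < N)%N -> (b < N)%N ->
     rmem s 3 [:: 0; a; b]%N = \sum_(c < D) fval c * mom a b c) /\
  rmem s 4 [:: 0%N] = 1.

Lemma ensures_build_sdp s : ready s -> holds_moments s -> holds_values s ->
  ensures O B S build_sdp s holds_sdp.
Proof.
move=> s0 hm hv; apply/ensures_seq.
pose G jx := if jx is [:: _; a; b] then \sum_(c < D) fval c * mom a b c else 0.
have /ensures_weaken : ensures O B S
  (For 11 gram_size (For 12 gram_size
         (rsum 13 value_size 3 [:: NConst 0; nvar 11; nvar 12]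
            (RMul (rvar 8 [:: 13]) (rvar 7 [:: 11; 12; 13])))))%N s (fills 3
    (fun jx => has (fun a => has (fun b => jx == [:: 0; a; b]%N) (iota 0 N))
      (iota 0 N)) G s).
  rewrite -{2}(ready_gram s0).
  apply: ensures_for_fills; rewrite (ready_gram s0) // => a s1 aN f1.
  have r1 : ready (set_n s1 11 [::] a) by exact: ready_for_step f1.
  rewrite -(ready_gram r1).
  apply: ensures_for_fills; rewrite (ready_gram r1) // => b s2 bN f2.
  have r2 : ready (set_n s2 12 [::] b) by exact: ready_for_step f2.
  set s3 := set_n s2 12 [::] b in r2 *.
  have v12 : nmem s3 12 [::] = b by [].
  have v11 : nmem s3 11 [::] = a by rewrite /s3 /= /upd /= f2.1.
  apply: ensures_weaken (ensures_rsum (M := D) (ixv := [:: 0; a; b]%N)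
    (X := fun c => fval c * mom a b c) _ _ _ _ _ _) _ => //.
  - by move=> s' f; rewrite /= !f.1 // v11 v12.
  - by move=> s' f; apply: ready_value; apply: ready_same r2; last exact: f.
  - move=> s' c cD f s'c /=; rewrite s'c !f.1 // !f.2 // v11 v12.
    by rewrite !f2.2 // !f1.2 // hv // hm.
  by move=> s' _; apply: fills_pred1.
apply=> s1 f1 F; apply: ensures_rset; split; last by rewrite /= /upd.
move=> a b aN bN; rewrite /= /upd /= F.
by rewrite (has_iota aN) // (has_iota bN).
Qed.

(** The program as the machine reads it, with sums over positions; it becomes the feasibility
    problem for [gram_mx] through [big_multisets]. *)
Definition sdp_of_memory : sdp R N 1 :=
  Sdp 0 (fun=> \matrix_(a, b) \sum_(c < D) fval c * mom a b c) (fun=> 1).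

Lemma ensures_solve s : ready s -> holds_sdp s -> (forall ix, rmem s 5 ix = 0) ->
  (N * N * 3 + 1 + o_sdptime O N 1 <= S)%N ->
  ensures O B S solve_sdp s (fun s' =>
    match o_sdp O sdp_of_memory with
    | SdpInfeasible => nmem s' 2 [::] = 0%N
    | SdpOptimal X => nmem s' 2 [::] = 2%N /\
        forall a b : 'I_N, rmem s' 6 [:: val a; val b] = X a b
    | _ => True
    end).
Proof.
move=> s0 [hA hb] hc hS.
apply: (@ensures_solve_sdp _ _ _ _ O B S _ _ _ _ _ _ _ _ _ N 1 _ _ hS) => //.
  exact: ready_gram.
have -> : read_sdp N 1 s 5 3 4 = sdp_of_memory.
  congr Sdp; first by apply/matrixP => i j; rewrite !mxE hc.
    by apply/funext => k; apply/matrixP => i j; rewrite !mxE ord1 hA ?ltn_ord.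
  by apply/funext => k; rewrite ord1 hb.
case: o_sdp => //= X; split=> // a b.
by rewrite /upd_mx eqxx !valK.
Qed.

Definition holds_weights (w : nat -> R) s : Prop :=
  forall c, (c < D)%N -> rmem s 11 [:: c] = w c.

Lemma ensures_get_weights s : ready s -> holds_moments s ->
  ensures O B S get_weights s (holds_weights (fun c =>
    \sum_(a < N) \sum_(b < N) rmem s 6 [:: val a; val b] * mom a b c)).
Proof.
move=> s0 hm; apply/ensures_seq.
pose w c a := \sum_(b < N) rmem s 6 [:: a; val b] * mom a b c.
pose G jx := if jx is [:: c; a] then w c a else 0.
have /ensures_weaken : ensures O B S
  (For 13 value_size (For 11 gram_size
         (rsum 12 gram_size 12 [:: nvar 13; nvar 11]
            (RMul (rvar 6 [:: 11; 12]) (rvar 7 [:: 11; 12; 13])))))%N s (fills 12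
    (fun jx => has (fun c => has (fun a => jx == [:: c; a]) (iota 0 N))
      (iota 0 D)) G s).
  rewrite -(ready_value s0).
  apply: ensures_for_fills; rewrite (ready_value s0) // => c s1 cD f1.
  have r1 : ready (set_n s1 13 [::] c) by exact: ready_for_step f1.
  rewrite -(ready_gram r1).
  apply: ensures_for_fills; rewrite (ready_gram r1) // => a s2 aN f2.
  have r2 : ready (set_n s2 11 [::] a) by exact: ready_for_step f2.
  set s3 := set_n s2 11 [::] a in r2 *.
  have v11 : nmem s3 11 [::] = a by [].
  have v13 : nmem s3 13 [::] = c by rewrite /s3 /= /upd /= f2.1.
  apply: ensures_weaken (ensures_rsum (M := N) (ixv := [:: c; a])
    (X := fun b => rmem s 6 [:: a; b] * mom a b c) _ _ _ _ _ _) _ => //.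
  - by move=> s' f; rewrite /= !f.1 // v11 v13.
  - by move=> s' f; apply: ready_gram; apply: ready_same r2; last exact: f.
  - move=> s' b bN f s'b /=; rewrite s'b !f.1 // !f.2 // v11 v13.
    by rewrite !f2.2 // !f1.2 // hm.
  by move=> s' _; apply: fills_pred1.
apply=> s1 f1 F.
have r1 : ready s1 by apply: ready_same s0; last exact: f1.
pose G' jx := if jx is [:: c] then \sum_(a < N) w c a else 0.
have /ensures_weaken : ensures O B S
  (For 13 value_size (rsum 11 gram_size 11 [:: nvar 13] (rvar 12 [:: 13; 11])))%N s1
  (fills 11 (fun jx => has (fun c => jx == [:: c]) (iota 0 D)) G' s1).
  rewrite -(ready_value r1).
  apply: ensures_for_fills; rewrite (ready_value r1) // => c s2 cD f2.
  have r2 : ready (set_n s2 13 [::] c) by exact: ready_for_step f2.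
  set s3 := set_n s2 13 [::] c in r2 *.
  have v13 : nmem s3 13 [::] = c by [].
  apply: ensures_weaken (ensures_rsum (M := N) (ixv := [:: c])
    (X := w c) _ _ _ _ _ _) _ => //.
  - by move=> s' f; rewrite /= !f.1 // v13.
  - by move=> s' f; apply: ready_gram; apply: ready_same r2; last exact: f.
  - move=> s' a aN f s'a /=; rewrite s'a !f.1 // !f.2 // v13.
    by rewrite !f2.2 // F (has_iota cD) // (has_iota aN).
  by move=> s' _; apply: fills_pred1.
by apply=> s2 _ F2 c cD; rewrite F2 (has_iota cD).
Qed.

Lemma ensures_build_cut s w : ready s -> holds_subgrads s -> holds_weights w s ->
  ensures O B S build_cut s (fun s' =>
    let a := \sum_(c < D) w c *: fgrad c in
    read_vec n s' 1 = a /\ rmem s' 2 [::] = dotv a x - 1).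
Proof.
move=> s0 hg hw; apply/ensures_seq.
pose a := \sum_(c < D) w c *: fgrad c.
pose G jx := if jx is [:: j] then
  if insub j is Some j' then a 0 (j' : 'I_n) else 0 else 0.
have s0n : neval s (nvar 0) = n by case: s0.
have /ensures_weaken : ensures O B S
  (For 14 (nvar 0) (rsum 13 value_size 1 [:: nvar 14]
         (RMul (rvar 11 [:: 13]) (rvar 9 [:: 13; 14]))))%N s
  (fills 1 (fun jx => has (fun j => jx == [:: j]) (iota 0 (neval s (nvar 0%N)))) G s).
  apply: ensures_for_fills; rewrite s0n // => j s1 jn f1.
  have r1 : ready (set_n s1 14 [::] j) by exact: ready_for_step f1.
  set s2 := set_n s1 14 [::] j in r1 *.
  have v14 : nmem s2 14 [::] = j by [].
  apply: ensures_weaken (ensures_rsum (M := D) (ixv := [:: j])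
    (X := fun c => w c * fgrad c 0 (Ordinal jn)) _ _ _ _ _ _) _ => //.
  - by move=> s' f; rewrite /= !f.1 // v14.
  - by move=> s' f; apply: ready_value; apply: ready_same r1; last exact: f.
  - move=> s' c cD f s'c /=; rewrite s'c !f.1 // !f.2 // v14.
    by rewrite !f1.2 // hw // -(hg _ (Ordinal jn) cD).
  move=> s' _; apply: fills_pred1 => //.
  rewrite /G insubT /a summxE; apply: eq_bigr => c _.
  by rewrite mxE.
apply=> s1 f1; rewrite s0n => F.
have r1 : ready s1 by apply: ready_same s0; last exact: f1.
have s1a (j : 'I_n) : rmem s1 1 [:: val j] = a 0 j.
  by rewrite F (has_iota (ltn_ord j)) // /G valK.
have xE (j : 'I_n) : rmem s1 0 [:: val j] = x 0 j.
  by case: r1 => _ _ _ _ <-; rewrite mxE.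
pose X j := if insub j is Some j' then a 0 (j' : 'I_n) * x 0 j' else 0.
apply/ensures_seq.
apply: ensures_weaken (ensures_rsum (M := n) (ixv := [::]) (X := X) _ _ _ _ _ _) _ => //.
- by move=> s' f; rewrite /= f.1 //; case: r1.
- move=> s' j jn f s'j /=; rewrite s'j !f.2 //.
  by rewrite (s1a (Ordinal jn)) (xE (Ordinal jn)) /X insubT.
move=> s2 f2 F2; apply: ensures_rset; split.
  by apply/rowP => j; rewrite !mxE /= upd_other // f2.2 // s1a.
rewrite /= /upd /= F2 /=; congr (_ + _).
by rewrite /dotv; apply: eq_bigr => j _; rewrite /X valK.
Qed.

(** Nothing is claimed for the two answers that [feasibility_solved] excludes, as correctness of the
    solver is not assumed here. *)
Lemma ensures_separation_program : (m < B)%N -> (r + d <= B)%N ->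
  (m.+1 ^ (r + d) <= B)%N -> (N * N * 3 + 1 + o_sdptime O N 1 <= S)%N ->
  ensures O B S separation_program (input m x) (fun s =>
    match o_sdp O sdp_of_memory with
    | SdpInfeasible => nmem s 2 [::] = 0%N
    | SdpOptimal X =>
        let a := \sum_(c < D) (\sum_(i < N) \sum_(j < N) X i j * mom i j c) *: fgrad c in
        [/\ nmem s 2 [::] = 2%N, read_vec n s 1 = a & rmem s 2 [::] = dotv a x - 1]
    | _ => True
    end).
Proof.
move=> mB' rdB eB hS; set s0 := input m x.
have zero_r a : a != 0%N -> rmem s0 a = fun=> 0.
  by move=> /negbTE a0; apply/funext => jx; rewrite /s0 /= /upd_vec a0.
apply/ensures_seq; apply: ensures_weaken (ensures_build_levels O S rdB mB' _ _ _ _) _ => //.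
  by move=> k kh; apply: leq_trans eB; rewrite leq_pexp2l // ltnW.
move=> s1 f1 L.
have r1 : ready s1.
  split; rewrite ?f1.1 //; [exact: L (leq_addr _ _)|exact: L (leq_addl _ _)|].
  by apply/rowP => j; rewrite mxE f1.2 //= /upd_vec eqxx valK.
have z1 : rmem s1 5 = fun=> 0 by rewrite f1.2 // zero_r.
apply/ensures_seq; apply: ensures_weaken (ensures_get_moments r1) _ => s2 f2 M2.
have r2 : ready s2 by apply: ready_same r1; last exact: f2.
apply/ensures_seq; apply: ensures_weaken (ensures_get_values r2) _ => s3 f3 V3.
have r3 : ready s3 by apply: ready_same r2; last exact: f3.
apply/ensures_seq; apply: ensures_weaken (ensures_get_subgrads r3) _ => s4 f4 G4.
have r4 : ready s4 by apply: ready_same r3; last exact: f4.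
have M4 : holds_moments s4 by move=> a b c aN bN cD; rewrite f4.2 // f3.2 // M2.
have V4 : holds_values s4 by move=> c cD; rewrite f4.2 // V3.
apply/ensures_seq; apply: ensures_weaken (ensures_build_sdp r4 M4 V4) _ => s5 f5 A5.
have r5 : ready s5 by apply: ready_same r4; last exact: f5.
have M5 : holds_moments s5 by move=> a b c aN bN cD; rewrite f5.2 // M4.
have G5 : holds_subgrads s5 by move=> c j cD; rewrite f5.2 // G4.
have z5 ix : rmem s5 5 ix = 0 by rewrite f5.2 // f4.2 // f3.2 // f2.2 // z1.
apply/ensures_seq; apply: ensures_weaken (ensures_solve r5 A5 z5 hS) _ => s6 f6 X6.
have r6 : ready s6 by apply: ready_same r5; last exact: f6.
have M6 : holds_moments s6 by move=> a b c aN bN cD; rewrite f6.2 // M5.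
have G6 : holds_subgrads s6 by move=> c j cD; rewrite f6.2 // G5.
apply/ensures_seq; apply: ensures_weaken (ensures_get_weights r6 M6) _ => s7 f7 W7.
have r7 : ready s7 by apply: ready_same r6; last exact: f7.
have G7 : holds_subgrads s7 by move=> c j cD; rewrite f7.2 // G6.
apply: ensures_weaken (ensures_build_cut r7 G7 W7) _ => s8 f8 [a8 b8].
case: o_sdp X6 => [|//|X|//] X6; first by rewrite f8.1 // f7.1.
case: X6 => n6 X6.
have e : \sum_(c < D) (\sum_(a < N) \sum_(b < N)
      rmem s6 6 [:: val a; val b] * mom a b c) *: fgrad c =
    \sum_(c < D) (\sum_(i < N) \sum_(j < N) X i j * mom i j c) *: fgrad c.
  apply: eq_bigr => c _; congr (_ *: _); apply: eq_bigr => i _.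
  by apply: eq_bigr => j _; rewrite X6.
by split; [rewrite f8.1 // f7.1|rewrite a8 e|rewrite b8 e].
Qed.

End Phases.
End Oracle.

(** * Closure properties of polynomial bounds *)

Section PolynomialBounds.
Variables (J : Type) (size : J -> nat).
Local Notation PB := (polynomially_bounded size).

Lemma polynomially_bounded_le (t t' : J -> nat) :
  (forall j, t j <= t' j)%N -> PB t' -> PB t.
Proof. by move=> h [a [k H]]; exists a, k => j; exact: leq_trans (h j) (H j). Qed.

Lemma polynomially_bounded_const c : PB (fun=> c).
Proof. by exists c, 0%N => j; rewrite muln1. Qed.

Lemma polynomially_bounded_size (t : J -> nat) : (forall j, t j <= size j)%N -> PB t.
Proof.
by move=> h; exists 1%N, 1%N => j; rewrite mul1n expn1 (leq_trans (h j)).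
Qed.

Lemma polynomially_bounded_add t u : PB t -> PB u -> PB (fun j => t j + u j)%N.
Proof.
move=> [a [k H]] [b [l K]]; exists (a + b)%N, (k + l)%N => j.
rewrite mulnDl leq_add // ?(leq_trans (H j)) ?(leq_trans (K j)) //.
  by rewrite leq_mul // leq_pexp2l // leq_addr.
by rewrite leq_mul // leq_pexp2l // leq_addl.
Qed.

Lemma polynomially_bounded_mul t u : PB t -> PB u -> PB (fun j => t j * u j)%N.
Proof.
move=> [a [k H]] [b [l K]]; exists (a * b)%N, (k + l)%N => j.
by rewrite expnD mulnACA leq_mul.
Qed.

Lemma polynomially_bounded_exp t e : PB t -> PB (fun j => t j ^ e)%N.
Proof.
move=> ht; elim: e => [|e IH]; first exact: polynomially_bounded_const.
apply: polynomially_bounded_le (polynomially_bounded_mul ht IH) => j.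
by rewrite expnS.
Qed.

(** For a fixed text [c], [time_bound] is built by sums and products from constants and the five
    bounded quantities. *)
Lemma polynomially_bounded_time (R : realType) d (n m : J -> nat)
    (O : forall j, oracles R (n j) (m j) d) (B S : J -> nat) c :
  PB n -> PB m -> PB (fun j => o_functime (O j)) -> PB B -> PB S ->
  PB (fun j => time_bound (O j) (B j) (S j) c).
Proof.
move=> hn hm hf hB hS.
have C := polynomially_bounded_const; have A := polynomially_bounded_add.
have M := polynomially_bounded_mul.
have A1 t : PB t -> PB (fun j => (t j).+1).
  by move=> /(A _ _ (C 1%N)); exact: polynomially_bounded_le.
elim: c => /=; intros; repeat first [exact: C | exact: hn | exact: hm | exact: hf
  | exact: hB | exact: hS | assumption | apply A1 | apply A | apply M].
Qed.

End PolynomialBounds.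

(** * Convexity and the oracle for a family of instances *)

Theorem theorem1 (R : realType) (r d : nat) (r_gt1 : (1 < r)%N)
  (I : Type) (n m : I -> nat)
  (K : forall i, set 'rV[R]_(m i))
  (mu : forall i, {finite_measure set (borelRV R (m i)) -> \bar R})
  (f : forall i, exponent_le (m i) d -> 'rV[R]_(n i) -> R)
  (K_closed : forall i, closed (K i))
  (K_interior : forall i, interior (K i) !=set0)
  (mu_supported : forall i, mu i (~` K i) = 0%E)
  (moments_finite : forall i (alpha : exponent (m i)),
     (mu i).-integrable (K i : set (borelRV R (m i)))
       (fun z => (monomial alpha z)%:E))
  (f_convex : forall i beta,
     convex_function [set: convex_lmodType 'rV[R]_(n i)] (f i beta))
  (g : forall i, exponent_le (m i) d -> 'rV[R]_(n i) -> 'rV[R]_(n i))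
  (g_subgradient : forall i beta x, is_subgradient (f i beta) x (g i beta x))
  (tf : I -> nat)
  (tf_polynomial : polynomially_bounded (fun i => n i + m i)%N tf)
  (solver : sdp_solver R)
  (solver_correct : correct_sdp_solver solver)
  (tsdp : nat -> nat -> nat)
  (tsdp_polynomial :
     polynomially_bounded (fun Np : nat * nat => Np.1 + Np.2)%N
       (fun Np => tsdp Np.1 Np.2))
  (K_nonneg : forall i, K i `<=` @nonneg_orthant R (m i)) :
  let C := fun i => [set x : 'rV[R]_(n i) | (fK (mu i) (K i) (f i) r x <= 0)%E] in
  (forall i, convex_set (C i : set (convex_lmodType 'rV[R]_(n i)))) /\
  polytime_separation_oracle
    (fun i => Oracles (moment (mu i) (K i)) (f i) (g i) (tf i) solver tsdp) C.
Proof.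
move=> C.
split=> [i|]; first exact: fK_le0_convex.
exists (separation_program r d).
(* A common bound for all loops: coordinates, letters, levels, and the sizes of all levels up to
   [r + d]. *)
pose B i := (n i + (m i).+1 + (r + d) + (m i).+1 ^ (r + d))%N.
pose N i := size (multisets (m i) r).
(* The machine charges for one constraint matrix, the objective and the solution, hence the factor
   3, and for one right-hand side. *)
pose S i := (N i * N i * 3 + 1 + tsdp (N i) 1)%N.
pose O i : oracles R (n i) (m i) d :=
  Oracles (moment (mu i) (K i)) (f i) (g i) (tf i) solver tsdp.
have sizeB i k : (k <= r + d)%N -> (size (multisets (m i) k) <= B i)%N.
  move=> kh; apply: leq_trans (size_multisets _ _) _.
  by apply: leq_trans (leq_addl _ _); rewrite leq_pexp2l.
have nB i : (n i <= B i)%N by rewrite /B; lia.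
have mB i : (m i < B i)%N by rewrite /B; lia.
have hB i : (r + d <= B i)%N by rewrite /B; lia.
have eB i : ((m i).+1 ^ (r + d) <= B i)%N by rewrite leq_addl.
have run_program i x := @ensures_separation_program r d R (n i) (m i) (O i) (B i) (S i) x
  (sizeB i r (leq_addr _ _)) (sizeB i d (leq_addl _ _)) (ltnW (mB i)) (nB i) (mB i)
  (hB i) (eB i) (leqnn _).
split=> [i x|]; last first.
  pose Q := ({i : I & 'rV[R]_(n i)} : Type); pose size (q : Q) := (n (tag q) + m (tag q))%N.
  have PBm1 e : polynomially_bounded size (fun q => (m (tag q)).+1 ^ e)%N.
    apply: polynomially_bounded_exp; exists 1%N, 1%N => q.
    by rewrite mul1n expn1 ltnS leq_addl.
  have PBN : polynomially_bounded size (fun q => N (tag q)).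
    by apply: polynomially_bounded_le (PBm1 r) => q; exact: size_multisets.
  have PBn : polynomially_bounded size (fun q => n (tag q)).
    by apply: polynomially_bounded_size => q; exact: leq_addr.
  have PBm : polynomially_bounded size (fun q => m (tag q)).
    by apply: polynomially_bounded_size => q; exact: leq_addl.
  (* A composition of polynomial bounds: the order [N] is polynomial in [m] because [r] is fixed. *)
  have PBtsdp : polynomially_bounded size (fun q => tsdp (N (tag q)) 1).
    case: tsdp_polynomial => a [k H].
    apply: (@polynomially_bounded_le _ _ _ (fun q => a * (N (tag q) + 2) ^ k)%N) => [q|].
      by have := H (N (tag q), 1%N); rewrite /= addn1 !addnS addn0.
    apply: polynomially_bounded_mul; first exact: polynomially_bounded_const.
    apply/polynomially_bounded_exp/polynomially_bounded_add => //.
    exact: polynomially_bounded_const.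
  apply: polynomially_bounded_le (polynomially_bounded_time (O := fun q => O (tag q))
    (B := fun q => B (tag q)) (S := fun q => S (tag q)) (separation_program r d) _ _ _ _ _).
  - by move=> [i x] /=; case: (run_program i x).
  - exact: PBn.
  - exact: PBm.
  - case: tf_polynomial => a [k H]; exists a, k => q; exact: H.
  - have := PBm1 1%N; under eq_fun do rewrite expn1; move=> PBm1'.
    by do !apply: polynomially_bounded_add => //; exact: polynomially_bounded_const.
  - do 2!apply: polynomially_bounded_add => //; last exact: polynomially_bounded_const.
    apply: polynomially_bounded_mul; last exact: polynomially_bounded_const.
    exact: polynomially_bounded_mul.
have [_] := run_program i x.
have gramE : sdp_of_memory r (O i) x = Sdp 0 (fun=> gram_mx (mu i) (K i) r (f i) x) (fun=> 1).
  congr Sdp; apply/funext => _; apply/matrixP => a b; rewrite !mxE.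
  rewrite (big_multisets d (fun al => (if insub al is Some beta then f i beta x else 0) *
     moment (mu i) (K i) (mpoly.mnm_add (mpoly.mnm_add (exps (m i) r a) (exps (m i) r b)) al))).
  by apply: eq_bigr => beta _; rewrite valK.
have cutE (X : 'M[R]_(N i)) :
    \sum_(c < size (multisets (m i) d))
      (\sum_(a < N i) \sum_(b < N i) X a b * mom r (O i) a b c) *: fgrad (O i) x c =
    \sum_(b : exponent_le (m i) d) weight (mu i) (K i) X b *: g i b x.
  rewrite (big_multisets d (fun al => weight (mu i) (K i) X al *:
     (if insub al is Some beta then g i beta x else 0))).
  by apply: eq_bigr => b _; rewrite valK.
(* The solver is only trusted on symmetric data; the entries of [gram_mx] depend on the sum of the
   two exponents. *)
have solved : sdp_solved (sdp_of_memory r (O i) x) (o_sdp (O i) (sdp_of_memory r (O i) x)).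
  apply: solver_correct; rewrite gramE; split=> [|k] /=; first exact: trmx0.
  exact: gram_sym.
move: solved; rewrite gramE => /feasibility_solved -/(_ (K_closed i) (moments_finite i)).
rewrite -gramE; set s := (run _ _ _).2.
rewrite /out_member /out_normal /out_bound.
case: o_sdp => [xC -> //|//|X [Xp X1] [-> -> ->]|//] /=.
rewrite cutE; split=> [y yC|]; last by rewrite ltrBlDr ltrDl.
exact: subgradient_cut.
Qed.
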